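(* In the setting described in the context, let $P:V\to V_{\mathrm{nc}}$ be the Petrov–Galerkin operator that maps $v\in V$ to the unique $Pv\in V_{\mathrm{nc}}$ with $$a_{\mathrm{pw}}(v-Pv,Jv_{\mathrm{nc}})=0\quad\text{for all }v_{\mathrm{nc}}\in V_{\mathrm{nc}}$$ (equivalently, $a_{\mathrm{pw}}(Pv,v_{\mathrm{nc}})=a(v,Jv_{\mathrm{nc}})$ for all $v_{\mathrm{nc}}\in V_{\mathrm{nc}}$), and let $$C_{\mathrm{qo}}:=\sup_{v\in V\setminus V_{\mathrm{nc}}}\frac{|\!|\!| v-Pv|\!|\!|_{\mathrm{pw}}}{|\!|\!| v-I_{\mathrm{nc}}v|\!|\!|_{\mathrm{pw}}}.$$ Then $C_{\mathrm{qo}}=\sqrt{1+\Lambda_0^2}=\|J\|$.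
   Context: Let $m\in\mathbb N$, let $\Omega\subset\mathbb R^2$ be a planar bounded Lipschitz domain with polygonal boundary, $V:=H^m_0(\Omega)$, and $a(v,w):=\int_\Omega D^m v:D^m w\,dx$ for $v,w\in V$. Write $\|\cdot\|_{L^2}:=\|\cdot\|_{L^2(\Omega)}$. Let $\mathcal T$ be a shape-regular triangulation of $\Omega$ into triangles, $P_k(\mathcal T)$ the space of piecewise polynomials of total degree at most $k$, $H^m(\mathcal T):=\{v\in L^2(\Omega): v|_T\in H^m(T)\ \forall T\in\mathcal T\}$, and $h_{\mathcal T}\in P_0(\mathcal T)$ with $h_{\mathcal T}|_T=\mathrm{diam}(T)$. Set $a_{\mathrm{pw}}(v,w):=\sum_{T\in\mathcal T}\int_T D^m v:D^m w\,dx$ for $v,w\in H^m(\mathcal T)$ and $|\!|\!| v|\!|\!|_{\mathrm{pw}}:=a_{\mathrm{pw}}(v,v)^{1/2}$. $V_{\mathrm{nc}}\subset P_m(\mathcal T)$ is a linear subspace on which $|\!|\!|\cdot|\!|\!|_{\mathrm{pw}}$ is a norm. There are an interpolation operator $I_{\mathrm{nc}}:V\to V_{\mathrm{nc}}$ and a constant $\kappa_m>0$ with, for all $v\in V$ and $w_m\in P_m(\mathcal T)$, $$a_{\mathrm{pw}}(v-I_{\mathrm{nc}}v,w_m)=0,\qquad \|h_{\mathcal T}^{-m}(v-I_{\mathrm{nc}}v)\|_{L^2}\le\kappa_m|\!|\!| v-I_{\mathrm{nc}}v|\!|\!|_{\mathrm{pw}}.$$ (Then $(V+V_{\mathrm{nc}},a_{\mathrm{pw}})$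 is a Hilbert space and $I_{\mathrm{nc}}$ is the restriction to $V$ of the orthogonal projection onto $V_{\mathrm{nc}}$.) There are a linear operator $J:V_{\mathrm{nc}}\to V$ and a constant $\Lambda_{\mathrm J}$ such that for all $v_{\mathrm{nc}}\in V_{\mathrm{nc}}$ and $v\in V$: $I_{\mathrm{nc}}Jv_{\mathrm{nc}}=v_{\mathrm{nc}}$ and $|\!|\!| v_{\mathrm{nc}}-Jv_{\mathrm{nc}}|\!|\!|_{\mathrm{pw}}\le\Lambda_{\mathrm J}|\!|\!| v_{\mathrm{nc}}-v|\!|\!|_{\mathrm{pw}}$. Standing assumptions: $V\setminus V_{\mathrm{nc}}\neq\emptyset$ and $V_{\mathrm{nc}}\neq\{0\}$. Definitions: $\Lambda_0:=\sup_{v_{\mathrm{nc}}\in V_{\mathrm{nc}}\setminus\{0\}}|\!|\!| v_{\mathrm{nc}}-Jv_{\mathrm{nc}}|\!|\!|_{\mathrm{pw}}/|\!|\!| v_{\mathrm{nc}}|\!|\!|_{\mathrm{pw}}$, and $\|J\|:=\sup_{v_{\mathrm{nc}}\in V_{\mathrm{nc}}\setminus\{0\}}|\!|\!| Jv_{\mathrm{nc}}|\!|\!|_{\mathrm{pw}}/|\!|\!| v_{\mathrm{nc}}|\!|\!|_{\mathrm{pw}}$ is the operator norm of $J:V_{\mathrm{nc}}\to V$. *)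

(* Defs.v *)
From HB Require Import structures.
From mathcomp Require Import all_boot all_order all_algebra.
From mathcomp Require Import all_classical all_reals all_analysis.
Set Implicit Arguments.
Unset Strict Implicit.
Unset Printing Implicit Defensive.
Import Order.TTheory GRing.Theory Num.Theory.
Import numFieldNormedType.Exports.
Local Open Scope classical_set_scope.
Local Open Scope ring_scope.

Section plane_geometry.
Context {R : realType}.
Implicit Types (x y p q : R * R) (A Omega : set (R * R)).

(* The norm of [R * R] in the library is the max norm. *)
Definition dist2 x y : R :=
  Num.sqrt ((x.1 - y.1) ^+ 2 + (x.2 - y.2) ^+ 2).

Definition diam A : R :=
  sup [set r | exists x y, [/\ A x, A y & r = dist2 x y]].

Definition segment p q : set (R * R) :=
  [set z | exists2 t : R, 0 <= t <= 1 & z = (1 - t) *: p + t *: q].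

(* In the Cartesian frame with origin at the boundary point [x] rotated by the
   angle of cosine [c] and sine [s], Omega is, inside a disc around [x], the
   strict epigraph of a Lipschitz function. *)
Definition lipschitz_boundary Omega : Prop :=
  forall x, (closure Omega `\` Omega) x ->
  exists (c s r : R) (gamma : R -> R),
    [/\ c ^+ 2 + s ^+ 2 = 1, 0 < r, [lipschitz gamma t | t in setT] &
        forall y, dist2 x y < r ->
          (Omega y <->
           gamma (c * (y.1 - x.1) + s * (y.2 - x.2)) <
             c * (y.2 - x.2) - s * (y.1 - x.1))].

Definition polygonal_boundary Omega : Prop :=
  exists (n : nat) (p q : 'I_n -> R * R),
    closure Omega `\` Omega = \bigcup_i segment (p i) (q i).

Definition polygonal_lipschitz_domain Omega : Prop :=
  [/\ open Omega, connected Omega & Omega !=set0] /\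
  [/\ bounded_set Omega, lipschitz_boundary Omega & polygonal_boundary Omega].

Definition hull (t : 'I_3 -> R * R) (F : {set 'I_3}) : set (R * R) :=
  [set z | exists l : 'I_3 -> R,
     [/\ forall i, 0 <= l i, \sum_(i in F) l i = 1 &
         z = \sum_(i in F) l i *: t i]].

Definition triangle (t : 'I_3 -> R * R) : set (R * R) := hull t [set: 'I_3].

Definition nondegenerate (t : 'I_3 -> R * R) : Prop :=
  let a := t (inord 0) in let b := t (inord 1) in let c := t (inord 2) in
  (b.1 - a.1) * (c.2 - a.2) - (b.2 - a.2) * (c.1 - a.1) != 0.

(* A triangulation is given by the vertices of its N triangles. Two distinct
   triangles meet in the empty set, a common vertex or a common edge: the
   faces [hull t F] with [#|F| <= 2]. *)
Definition triangulation Omega N (T : 'I_N -> 'I_3 -> R * R) : Prop :=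
  [/\ forall j, nondegenerate (T j),
      closure Omega = \bigcup_j triangle (T j) &
      forall j k, j != k -> exists F G : {set 'I_3},
        [/\ (#|F| <= 2)%N, #|F| = #|G|,
            triangle (T j) `&` triangle (T k) = hull (T j) F &
            hull (T j) F = hull (T k) G]].

Definition shape_regular (sigma : R) N (T : 'I_N -> 'I_3 -> R * R) : Prop :=
  forall j, exists z (rho : R),
    [/\ 0 < rho, [set y | dist2 z y <= rho / 2] `<=` triangle (T j) &
        diam (triangle (T j)) <= sigma * rho].

(* The value on the edges is immaterial. *)
Definition mesh_size N (T : 'I_N -> 'I_3 -> R * R) x : R :=
  \sum_(j < N) diam (triangle (T j)) * \1_((triangle (T j))^°) x.

End plane_geometry.

(* Elements of L^2(U), and of its subspaces below, are represented by functions
   on the whole plane of which only the values on U matter; equality in L^2(U)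
   is [eqL2 U], equality almost everywhere on U. *)
Section function_spaces.
Context {R : realType}.
Implicit Types (U Omega : set (R * R)) (v w g phi : R * R -> R).

Local Notation leb2 := (@lebesgue_measure R \x @lebesgue_measure R)%E.

Definition L2 U : set (R * R -> R) := [set v | v \_ U \in Lfun leb2 2%:E].

Definition L2norm U v : \bar R := 'N[leb2]_2%:E[EFin \o (v \_ U)].

Definition eqL2 U v w : Prop := ae_eq leb2 U v w.

(* Partial derivatives of order k are indexed by the k-tuple of the directions
   of differentiation, so that [D^k v] is the tensor [(pder s v)_s]. *)
Definition unit_vec (i : 'I_2) : R * R := ((i == 0)%:R, (i == 1)%:R).

Definition pder (s : seq 'I_2) (f : R * R -> R) : R * R -> R :=
  foldr (fun i g x => 'D_(unit_vec i) g x) f s.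

Definition smooth phi : Prop :=
  forall s, continuous (pder s phi) /\
    forall i x, derivable (pder s phi) x (unit_vec i).

Definition test_function U phi : Prop :=
  let K := closure [set x | phi x != 0] in
  [/\ smooth phi, compact K & K `<=` U].

Definition weak_derivative U (s : seq 'I_2) v g : Prop :=
  forall phi, test_function U phi ->
    \int[leb2]_(x in U) (v x * pder s phi x) =
    (-1) ^+ size s * \int[leb2]_(x in U) (g x * phi x).

Definition Hm (m : nat) U : set (R * R -> R) :=
  [set v | L2 U v /\ forall s, (size s <= m)%N ->
     exists2 g, L2 U g & weak_derivative U s v g].

(* A representative of the weak derivative (unique almost everywhere on U). *)
Definition wder U (s : seq 'I_2) v : R * R -> R :=
  xget (cst 0) [set g | L2 U g /\ weak_derivative U s v g].

Definition Hm_norm (m : nat) U v : R :=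
  Num.sqrt (\sum_(k < m.+1) \sum_(s : k.-tuple 'I_2)
    \int[leb2]_(x in U) (wder U s v x ^+ 2)).

Definition Hm0 (m : nat) Omega : set (R * R -> R) :=
  [set v | Hm m Omega v /\ forall eps : R, 0 < eps ->
     exists2 phi, test_function Omega phi & Hm_norm m Omega (v - phi) < eps].

Definition energy_form (m : nat) U v w : R :=
  \int[leb2]_(x in U) \sum_(s : m.-tuple 'I_2) (wder U s v x * wder U s w x).

Definition pw_form (m : nat) N (T : 'I_N -> 'I_3 -> R * R) v w : R :=
  \sum_(j < N) energy_form m (triangle (T j))^° v w.

Definition pw_norm (m : nat) N (T : 'I_N -> 'I_3 -> R * R) v : R :=
  Num.sqrt (pw_form m T v v).

Definition polynomial2 (k : nat) (p : R * R -> R) : Prop :=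
  exists c : nat -> nat -> R, forall x,
    p x = \sum_(i < k.+1) \sum_(j < k.+1 | (i + j <= k)%N)
            c i j * x.1 ^+ i * x.2 ^+ j.

Definition pw_polynomial (k : nat) Omega N (T : 'I_N -> 'I_3 -> R * R) :
    set (R * R -> R) :=
  [set v | L2 Omega v /\ forall j : 'I_N,
     exists2 p, polynomial2 k p & eqL2 (triangle (T j))^° v p].

Definition L2_subspace Omega (W : set (R * R -> R)) : Prop :=
  [/\ W `<=` L2 Omega, W 0,
      forall (a : R) v w, W v -> W w -> W (a *: v + w) &
      forall v w, W v -> L2 Omega w -> eqL2 Omega v w -> W w].

Definition norm_on Omega (W : set (R * R -> R)) (N : (R * R -> R) -> R) : Prop :=
  [/\ forall v, W v -> 0 <= N v,
      forall v, W v -> (N v = 0 <-> eqL2 Omega v 0),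
      forall (a : R) v, W v -> N (a *: v) = `|a| * N v &
      forall v w, W v -> W w -> N (v + w) <= N v + N w].

(* An operator between spaces of functions modulo [eqL2 Omega]. *)
Definition operator Omega (A B : set (R * R -> R))
    (F : (R * R -> R) -> R * R -> R) : Prop :=
  (forall v, A v -> B (F v)) /\
  (forall v w, A v -> A w -> eqL2 Omega v w -> eqL2 Omega (F v) (F w)).

Definition linear_operator Omega (A B : set (R * R -> R))
    (F : (R * R -> R) -> R * R -> R) : Prop :=
  operator Omega A B F /\
  forall (a : R) v w, A v -> A w ->
    eqL2 Omega (F (a *: v + w)) (a *: F v + F w).

Definition nonzero Omega (W : set (R * R -> R)) : set (R * R -> R) :=
  [set w | W w /\ ~ eqL2 Omega w 0].

Definition petrov_galerkin (m : nat) N (T : 'I_N -> 'I_3 -> R * R)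
    (Vnc : set (R * R -> R)) (J : (R * R -> R) -> R * R -> R) v p : Prop :=
  Vnc p /\ forall w, Vnc w -> pw_form m T (v - p) (J w) = 0.

(* The suprema are taken in the extended reals. *)
Definition Lambda0 (m : nat) Omega N (T : 'I_N -> 'I_3 -> R * R)
    (Vnc : set (R * R -> R)) (J : (R * R -> R) -> R * R -> R) : \bar R :=
  ereal_sup [set (pw_norm m T (w - J w) / pw_norm m T w)%:E
            | w in nonzero Omega Vnc].

Definition opnorm (m : nat) Omega N (T : 'I_N -> 'I_3 -> R * R)
    (Vnc : set (R * R -> R)) (J : (R * R -> R) -> R * R -> R) : \bar R :=
  ereal_sup [set (pw_norm m T (J w) / pw_norm m T w)%:E
            | w in nonzero Omega Vnc].

Definition Cqo (m : nat) N (T : 'I_N -> 'I_3 -> R * R)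
    (V Vnc : set (R * R -> R)) (Inc P : (R * R -> R) -> R * R -> R) : \bar R :=
  ereal_sup [set (pw_norm m T (v - P v) / pw_norm m T (v - Inc v))%:E
            | v in V `\` Vnc].

End function_spaces.

(* Main.v *)
Require Import Defs.
From HB Require Import structures.
From mathcomp Require Import all_boot all_order all_algebra.
From mathcomp Require Import all_classical all_reals all_analysis.
From mathcomp Require Import measurable_realfun lra ring.
Import Order.TTheory GRing.Theory Num.Theory.
Import numFieldNormedType.Exports.
Local Open Scope classical_set_scope.
Local Open Scope ring_scope.

Set Implicit Arguments.
Unset Strict Implicit.
Unset Printing Implicit Defensive.

(** The theorem is a statement about a semi-inner product [a]. For [w] in the
    nonconforming space [W], [J w - w] is orthogonal to [W], because [J] is a
    right inverse of the orthogonal projection [I]; hence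
    [|J w|^2 = |w|^2 + |w - J w|^2], which gives [|J| = sqrt (1 + Lambda0^2)].
    Similarly [|v - P v|^2 = |v - I v|^2 + |I v - P v|^2], and the defect is
    governed by the identity
      [a (I v - P v) w = a (v - I v) (w - J w)]   ([form_IP]).
    Cauchy--Schwarz and [w := I v - P v] bound the defect by
    [Lambda0 |v - I v|], hence [C_qo <= sqrt (1 + Lambda0^2)]. Conversely, for
    [v := J w] one has [v - I v = J w - w], and the identity tested with [w]
    gives [|w - J w|^2 <= |w| |I v - P v|]: the ratio at [J w] is at least
    [sqrt (1 + (|w - J w| / |w|)^2)]. No maximiser is needed, and the supremum
    over [w] is [sqrt (1 + Lambda0^2)] ([quasi_optimality_constants]). Existence
    and uniqueness of [P v] is the Riesz representation of
    [w |-> a v (J w)] in [W], because [a p (J w) = a p w] for [p] in [W]; piecewise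
    polynomials have finitely many coefficients, so orthonormal families in [W]
    have bounded length ([riesz_representation]).

    What remains is that the piecewise energy is a semi-inner product on a space
    that contains both [H^m_0] and [W]. The energy is defined through a chosen
    representative of the weak derivative, so bilinearity is the almost
    everywhere uniqueness of weak derivatives, that is, the fundamental lemma of
    the calculus of variations. It is proved with smooth functions that increase
    to the indicator of a rectangle, followed by a Dynkin argument from
    rectangles to measurable sets ([fundamental_lemma]). Piecewise polynomials
    have weak derivatives by integration by parts, which for compactly supported
    functions is Fubini and the one-dimensional fundamental theorem
    ([smooth_weak_derivative]).

    The geometry enters in three places. The interior of a triangle is contained
    in [Omega], because a Lipschitz domain is the interior of its closure
    ([interior_closure_lipschitz]); so weak derivatives on [Omega] restrict to
    triangles. These interiors cover almost every point of [Omega] exactly once,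
    because faces lie on lines ([triangulation_ae]); so the piecewise form agrees
    with the energy on [H^m_0]. Finally, the mesh size is positive there, so that
    the weighted estimate for [I] turns [|v - I v| = 0] into [v = I v] almost
    everywhere ([mesh_L2norm_eq0]). *)

Local Notation plane R := (measurableTypeR R * measurableTypeR R)%type.

(** * Semi-inner products and quasi-optimality *)

Definition linear_subspace (R : pzRingType) (E : lmodType R) (X : E -> Prop) : Prop :=
  X 0 /\ forall (c : R) u v, X u -> X v -> X (c *: u + v).

Definition linear_on (R : pzRingType) (E : lmodType R) (X : E -> Prop) (f : E -> R) : Prop :=
  forall (c : R) u v, X u -> X v -> f (c *: u + v) = c * f u + f v.

(** Positive and not definite, since functions are not identified with their almost everywhere
    classes; [X] is the set on which the form is bilinear. *)
Definition semi_inner_product (R : realType) (E : lmodType R) (X : E -> Prop)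
    (a : E -> E -> R) : Prop :=
  [/\ linear_subspace X, forall w, X w -> linear_on X (a^~ w),
      forall u v, a u v = a v u & forall u, 0 <= a u u].

Section subspace.
Variables (R : pzRingType) (E : lmodType R) (X : E -> Prop).
Hypothesis sX : linear_subspace X.

Lemma subspace0 : X 0. Proof. exact: sX.1. Qed.
Lemma subspaceZ c u : X u -> X (c *: u).
Proof. by move=> Xu; rewrite -[_ *: _]addr0; apply: sX.2 => //; exact: sX.1. Qed.
Lemma subspaceD u v : X u -> X v -> X (u + v).
Proof. by move=> Xu Xv; rewrite -[u]scale1r; exact: sX.2. Qed.
Lemma subspaceN u : X u -> X (- u).
Proof. by move=> Xu; rewrite -scaleN1r; exact: subspaceZ. Qed.
Lemma subspaceB u v : X u -> X v -> X (u - v).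
Proof. by move=> Xu Xv; apply: subspaceD => //; exact: subspaceN. Qed.
Lemma subspace_sum n (F : 'I_n -> E) : (forall i, X (F i)) -> X (\sum_i F i).
Proof. by move=> XF; elim/big_ind: _ => //; [exact: subspace0|exact: subspaceD]. Qed.

Variable f : E -> R.
Hypothesis lf : linear_on X f.
Lemma linear_on0 : f 0 = 0.
Proof.
have := lf 1 subspace0 subspace0.
by rewrite scaler0 addr0 mul1r => /eqP; rewrite -subr_eq subrr eq_sym => /eqP.
Qed.
Lemma linear_onZ c u : X u -> f (c *: u) = c * f u.
Proof. by move=> Xu; rewrite -[_ *: _]addr0 lf ?linear_on0 ?addr0//; exact: subspace0. Qed.
Lemma linear_onD u v : X u -> X v -> f (u + v) = f u + f v.
Proof. by move=> Xu Xv; rewrite -[u]scale1r lf// mul1r scale1r. Qed.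
Lemma linear_onB u v : X u -> X v -> f (u - v) = f u - f v.
Proof.
by move=> Xu Xv; rewrite -scaleN1r linear_onD// ?linear_onZ ?mulN1r//; exact: subspaceZ.
Qed.
Lemma linear_on_sum n (F : 'I_n -> E) : (forall i, X (F i)) ->
  f (\sum_i F i) = \sum_i f (F i).
Proof.
elim: n F => [|n IH] F XF; first by rewrite !big_ord0 linear_on0.
by rewrite !big_ord_recr /= linear_onD ?IH//; exact: subspace_sum.
Qed.
End subspace.

(** The last clause is the continuity of the increasing map [x |-> sqrt (1 + x^2)]: a bound of its
    values at the [f i] bounds its value at their supremum. *)
Lemma ereal_sup_sqrt (R : realType) (I : Type) (S : set I) (f : I -> R) (L : R) :
  S !=set0 -> (forall i, S i -> 0 <= f i <= L) ->
  exists r : R, [/\ 0 <= r, forall i, S i -> f i <= r,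
    ereal_sup [set (f i)%:E | i in S] = r%:E &
    forall y : \bar R, (forall i, S i -> ((Num.sqrt (1 + f i ^+ 2))%:E <= y)%E) ->
      ((Num.sqrt (1 + r ^+ 2))%:E <= y)%E].
Proof.
move=> [i0 Si0] fL; set A := [set _ | _ in S].
have ub i : S i -> ((f i)%:E <= ereal_sup A)%E.
  by move=> Si; apply: ereal_sup_ubound; exists i.
have supL : (ereal_sup A <= L%:E)%E.
  by apply: ge_ereal_sup => _ [i Si <-]; rewrite lee_fin; have /andP[] := fL _ Si.
have fin : ereal_sup A \is a fin_num.
  rewrite fin_numE; apply/andP; split; apply/eqP => E.
    by have := ub _ Si0; rewrite E leeNy_eq.
  by move: supL; rewrite E leye_eq.
exists (fine (ereal_sup A)); rewrite fineK//.
have le_sup i : S i -> f i <= fine (ereal_sup A) by move=> /ub; rewrite -{1}(fineK fin) lee_fin.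
have r0 : 0 <= fine (ereal_sup A).
  by apply: le_trans (le_sup _ Si0); have /andP[] := fL _ Si0.
split => // y Hy.
case: y Hy => [y| |] Hy; last first.
- by have := Hy _ Si0; rewrite leeNy_eq.
- by rewrite leey.
have y1 i : S i -> 1 + f i ^+ 2 <= y ^+ 2 /\ 0 <= y.
  move=> /Hy; rewrite lee_fin => H; split; last by apply: le_trans H; exact: sqrtr_ge0.
  rewrite -[leLHS]sqr_sqrtr ?addr_ge0 ?sqr_ge0// lerXn2r// ?nnegrE ?sqrtr_ge0//.
  by apply: le_trans H; exact: sqrtr_ge0.
have y0 : 0 <= y := (y1 _ Si0).2.
have ry : fine (ereal_sup A) <= Num.sqrt (y ^+ 2 - 1).
  rewrite -lee_fin fineK//; apply: ge_ereal_sup => _ [i Si <-]; rewrite lee_fin.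
  have /andP[fi0 _] := fL _ Si.
  rewrite -(ger0_norm fi0) -sqrtr_sqr; apply: ler_wsqrtr.
  by rewrite lerBrDl; exact: (y1 _ Si).1.
rewrite lee_fin -(ger0_norm y0) -sqrtr_sqr; apply: ler_wsqrtr.
have d0 : 0 <= y ^+ 2 - 1.
  by rewrite subr_ge0; apply: le_trans (y1 _ Si0).1; rewrite lerDl sqr_ge0.
have : fine (ereal_sup A) ^+ 2 <= Num.sqrt (y ^+ 2 - 1) ^+ 2.
  by rewrite lerXn2r// nnegrE sqrtr_ge0.
by rewrite sqr_sqrtr// lerBrDl.
Qed.

Section semi_inner.
Variables (R : realType) (E : lmodType R) (X : E -> Prop) (a : E -> E -> R).
Hypothesis ha : semi_inner_product X a.
Let sX : linear_subspace X. Proof. by case: ha. Qed.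
Let al w : X w -> linear_on X (a^~ w). Proof. by case: ha => _ + _ _; apply. Qed.
Lemma formC u v : a u v = a v u. Proof. by case: ha. Qed.
Lemma form_ge0 u : 0 <= a u u. Proof. by case: ha. Qed.
Lemma formDl u v w : X u -> X v -> X w -> a (u + v) w = a u w + a v w.
Proof. by move=> Xu Xv Xw; exact: (linear_onD (al Xw)). Qed.
Lemma formBl u v w : X u -> X v -> X w -> a (u - v) w = a u w - a v w.
Proof. by move=> Xu Xv Xw; exact: (linear_onB sX (al Xw)). Qed.
Lemma formZl c u w : X u -> X w -> a (c *: u) w = c * a u w.
Proof. by move=> Xu Xw; exact: (linear_onZ sX (al Xw)). Qed.
Lemma form_suml n (F : 'I_n -> E) w : (forall i, X (F i)) -> X w ->
  a (\sum_i F i) w = \sum_i a (F i) w.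
Proof. by move=> XF Xw; exact: (linear_on_sum sX (al Xw)). Qed.
Lemma formDr u v w : X u -> X v -> X w -> a w (u + v) = a w u + a w v.
Proof. by move=> *; rewrite !(formC w) formDl. Qed.
Lemma formBr u v w : X u -> X v -> X w -> a w (u - v) = a w u - a w v.
Proof. by move=> *; rewrite !(formC w) formBl. Qed.
Lemma formZr c u w : X u -> X w -> a w (c *: u) = c * a w u.
Proof. by move=> *; rewrite !(formC w) formZl. Qed.

Lemma formNl u w : X u -> X w -> a (- u) w = - a u w.
Proof. by move=> Xu Xw; rewrite -scaleN1r formZl// mulN1r. Qed.

Definition seminorm u := Num.sqrt (a u u).

Lemma seminorm_ge0 u : 0 <= seminorm u. Proof. exact: sqrtr_ge0. Qed.
Lemma sqr_seminorm u : seminorm u ^+ 2 = a u u.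
Proof. by rewrite sqr_sqrtr ?form_ge0. Qed.
Lemma seminorm_eq0 u : (seminorm u == 0) = (a u u == 0).
Proof. by rewrite -sqr_seminorm sqrf_eq0. Qed.

(** Otherwise [t |-> a (t u + v) (t u + v)] would be affine and not constant, hence
    negative somewhere. *)
Lemma form_null u v : X u -> X v -> a u u = 0 -> a u v = 0.
Proof.
move=> Xu Xv u0; apply/eqP; apply: contraT => n0.
have := form_ge0 ((- (a v v + 1) / (2 * a u v)) *: u + v).
set c := _ / _.
rewrite formDl ?formDr// ?formZl ?formZr ?u0 ?(formC v u)//; try exact: subspaceZ; last first.
  by apply: subspaceD => //; exact: subspaceZ.
have -> : c * (c * 0) + c * a u v + (c * a u v + a v v) = -1.
  by rewrite /c; field; rewrite n0.
by rewrite ler0N1.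
Qed.

Lemma cauchy_schwarz u v : X u -> X v -> a u v <= seminorm u * seminorm v.
Proof.
move=> Xu Xv; have [u0|u0] := eqVneq (a u u) 0.
  by rewrite form_null// mulr_ge0// seminorm_ge0.
have [v0|v0] := eqVneq (a v v) 0.
  by rewrite formC form_null// mulr_ge0// seminorm_ge0.
have np w : a w w != 0 -> 0 < seminorm w.
  by move=> w0; rewrite lt_neqAle seminorm_ge0 eq_sym seminorm_eq0 w0.
have := form_ge0 (seminorm v *: u - seminorm u *: v).
rewrite formBl ?formBr// ?formZl ?formZr ?(formC v u) -?sqr_seminorm//;
  try (by apply: subspaceZ); last by apply: subspaceB => //; exact: subspaceZ.
have := mulr_gt0 (np _ u0) (np _ v0).
set x := seminorm u; set y := seminorm v => xy0.
move=> H; rewrite -(ler_pM2l xy0); lra.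
Qed.

Lemma pythagoras u v : X u -> X v -> a u v = 0 ->
  seminorm (u + v) ^+ 2 = seminorm u ^+ 2 + seminorm v ^+ 2.
Proof.
move=> Xu Xv uv; rewrite !sqr_seminorm formDl ?formDr ?(formC v u) ?uv ?addr0 ?add0r//.
exact: subspaceD.
Qed.

Lemma seminormN u : X u -> seminorm (- u) = seminorm u.
Proof.
move=> Xu; congr Num.sqrt; rewrite -scaleN1r formZl ?formZr//; first by ring.
exact: subspaceZ.
Qed.

Section riesz.
Variable W : E -> Prop.
Hypothesis sW : linear_subspace W.
Hypothesis WX : forall w, W w -> X w.

Definition orthonormal n (e : nat -> E) : Prop :=
  (forall i, (i < n)%N -> W (e i)) /\
  (forall i j, (i < n)%N -> (j < n)%N -> a (e i) (e j) = (i == j)%:R).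

(** Finite dimension up to null vectors: [C w c] says that [c] is a vector of
    coefficients of [w], which need not be unique. *)
Variables (D : nat) (C : E -> 'rV[R]_D -> Prop).
Hypothesis C0 : C 0 0.
Hypothesis Clin : forall (k : R) u v c d, C u c -> C v d -> C (k *: u + v) (k *: c + d).
Hypothesis Cnull : forall u, C u 0 -> a u u = 0.
Hypothesis Ctotal : forall w, W w -> exists c, C w c.

(** A longer family has a nontrivial linear combination with vanishing coefficients; it is a
    null vector, although its products with the family are the coefficients of the combination. *)
Lemma orthonormal_leq n e : orthonormal n e -> (n <= D)%N.
Proof.
move=> [We oe].
have We' (i : 'I_n) : W (e i) by exact: We.
have [M hM] := choice (fun i : 'I_n => Ctotal (We' i)).
rewrite leqNgt; apply/negP => Dn.
pose A : 'M[R]_(n, D) := \matrix_(i, k) M i 0 k.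
have : kermx A != 0.
  rewrite kermx_eq0; apply/negP => /eqP rA.
  by have := rank_leq_col A; rewrite rA leqNgt Dn.
case/rowV0Pn => v /sub_kermxP vA; apply/negP; rewrite negbK.
have Xe (i : 'I_n) : X (e i) by exact/WX.
have Xs : X (\sum_i v 0 i *: e i) by apply: (subspace_sum sX) => i; exact: subspaceZ.
have Cs : C (\sum_i v 0 i *: e i) (\sum_i v 0 i *: M i).
  elim: (index_enum _) => [|i r IH]; first by rewrite !big_nil.
  by rewrite !big_cons; exact: Clin.
have null : a (\sum_i v 0 i *: e i) (\sum_i v 0 i *: e i) = 0.
  apply: Cnull; suff -> : 0 = \sum_i v 0 i *: M i by [].
  apply/rowP => k; have /rowP/(_ k) := vA; rewrite !mxE summxE => vAk.
  by rewrite -[LHS]vAk; apply: eq_bigr => i _; rewrite !mxE.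
apply/eqP/rowP => j; rewrite !mxE.
have := form_null Xs (Xe j) null.
rewrite form_suml//; last by move=> i; exact: subspaceZ.
rewrite (bigD1 j)//= formZl// oe// eqxx mulr1 big1 ?addr0// => i ij.
by rewrite formZl// oe// val_eqE (negbTE ij) mulr0.
Qed.

(** Gram--Schmidt: were no element of [W] to represent [f], every orthonormal family could be
    enlarged, by an element [w] at which its Fourier sum fails to represent [f]. *)
Lemma riesz_representation (f : E -> R) :
  linear_on W f -> (forall w, W w -> a w w = 0 -> f w = 0) ->
  exists2 p, W p & forall w, W w -> a p w = f w.
Proof.
move=> lf f0; apply: contrapT => nex.
suff /(_ D.+1)[e /orthonormal_leq] : forall n, exists e, orthonormal n e.
  by rewrite ltnn.
elim=> [|n [e [We oe]]]; first by exists (fun=> 0); split.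
have Xe (i : 'I_n) : X (e i) by apply/WX/We.
have We' (i : 'I_n) : W (e i) by exact: We.
have /existsNP[w /not_implyP[Ww pw]] :
    ~ forall w, W w -> a (\sum_(i < n) f (e i) *: e i) w = f w.
  move=> H; apply: nex; exists (\sum_(i < n) f (e i) *: e i) => //.
  by apply: (subspace_sum sW) => i; exact: (subspaceZ sW).
have Xw := WX Ww.
pose u := w - \sum_(i < n) a w (e i) *: e i.
have Ws : W (\sum_(i < n) a w (e i) *: e i).
  by apply: (subspace_sum sW) => i; exact: (subspaceZ sW).
have Wu : W u by exact: (subspaceB sW).
have Xu := WX Wu.
have ue (i : 'I_n) : a u (e i) = 0.
  rewrite /u formBl//; last exact: WX.
  rewrite form_suml//; last by move=> j; exact: subspaceZ.
  rewrite (bigD1 i)//= formZl// oe// eqxx mulr1 big1 ?addr0 ?subrr// => j ji.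
  by rewrite formZl// oe// val_eqE (negbTE ji) mulr0.
have uu0 : a u u != 0.
  apply/negP => /eqP uu; apply: pw.
  have := f0 _ Wu uu; rewrite /u (linear_onB sW lf)// => /eqP.
  rewrite subr_eq0 => /eqP ->; rewrite (linear_on_sum sW lf); last first.
    by move=> i; exact: (subspaceZ sW).
  rewrite form_suml//; last by move=> i; exact: subspaceZ.
  apply: eq_bigr => i _; rewrite formZl// (linear_onZ sW lf)//.
  by rewrite mulrC formC.
have nu0 : seminorm u != 0 by rewrite seminorm_eq0.
exists (fun i => if (i < n)%N then e i else (seminorm u)^-1 *: u); split.
  by move=> i _; case: ifPn => [/We//|_]; exact: (subspaceZ sW).
have one : a ((seminorm u)^-1 *: u) ((seminorm u)^-1 *: u) = 1.
  rewrite formZl ?formZr//; last exact: subspaceZ.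
  by rewrite -sqr_seminorm; field.
have ort i : (i < n)%N -> a ((seminorm u)^-1 *: u) (e i) = 0.
  move=> lin; rewrite formZl//; last by apply/WX/We.
  by rewrite (ue (Ordinal lin)) mulr0.
move=> i j; rewrite !ltnS => lei lej.
have [lin|gei] := ltnP i n; have [ljn|gej] := ltnP j n.
- by rewrite oe.
- by rewrite formC ort// ltn_eqF// (leq_trans lin).
- by rewrite ort// gtn_eqF// (leq_trans ljn).
- rewrite one; suff -> : i = j by rewrite eqxx.
  by apply/eqP; rewrite eqn_leq (leq_trans lei gej) (leq_trans lej gei).
Qed.
End riesz.

Section quasi_optimality.
Variables (V W : E -> Prop) (I J P : E -> E).
Hypotheses (VX : forall v, V v -> X v) (sW : linear_subspace W).
Hypothesis WX : forall w, W w -> X w.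
Hypotheses (WI : forall v, V v -> W (I v)) (VJ : forall w, W w -> V (J w)).
Hypothesis WP : forall v, V v -> W (P v).
Hypothesis orthI : forall v w, V v -> W w -> a (v - I v) w = 0.
Hypothesis IJ : forall w z, W w -> X z -> a (I (J w) - w) z = 0.
Hypothesis galP : forall v w, V v -> W w -> a (v - P v) (J w) = 0.
Hypothesis nullI : forall v, V v -> seminorm (v - I v) = 0 -> W v.

(** [J w] and [w] have the same projection to [W]. *)
Lemma orthJ w z : W w -> W z -> a (J w - w) z = 0.
Proof.
move=> Ww Wz; have XJ := VX (VJ Ww); have XIJ := WX (WI (VJ Ww)).
have -> : J w - w = (J w - I (J w)) + (I (J w) - w) by rewrite subrKA.
rewrite formDl ?orthI ?IJ ?addr0//; try exact: WX; try exact: VJ.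
  by apply: subspaceB.
by apply: subspaceB => //; exact: WX.
Qed.

(** Pythagoras for [J w = w + (J w - w)], whose terms are orthogonal by [orthJ]. *)
Lemma sqr_seminorm_J w : W w ->
  seminorm (J w) ^+ 2 = seminorm w ^+ 2 + seminorm (w - J w) ^+ 2.
Proof.
move=> Ww; have Xw := WX Ww; have XJ := VX (VJ Ww).
have XB := subspaceB sX XJ Xw.
by rewrite -(opprB (J w)) seminormN// -pythagoras// ?[w + _]addrC ?subrK// formC orthJ.
Qed.

Lemma seminorm_ratio_J w : W w -> seminorm w != 0 ->
  seminorm (J w) / seminorm w =
  Num.sqrt (1 + (seminorm (w - J w) / seminorm w) ^+ 2).
Proof.
move=> Ww w0; rewrite -[LHS]ger0_norm ?divr_ge0 ?seminorm_ge0// -sqrtr_sqr.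
by congr Num.sqrt; rewrite !expr_div_n sqr_seminorm_J//; field.
Qed.

Lemma sqr_seminorm_P v : V v ->
  seminorm (v - P v) ^+ 2 = seminorm (v - I v) ^+ 2 + seminorm (I v - P v) ^+ 2.
Proof.
move=> Vv; have Xv := VX Vv; have XI := WX (WI Vv); have XP := WX (WP Vv).
rewrite -pythagoras ?subrKA//; [exact: subspaceB..|].
by rewrite orthI//; apply: (subspaceB sW); [exact: WI|exact: WP].
Qed.

(** Both sides equal [a v (w - J w)]: the first by the definitions of [I] and [P], the second
    because [w - J w] is orthogonal to [I v]. *)
Lemma form_IP v w : V v -> W w -> a (I v - P v) w = a (v - I v) (w - J w).
Proof.
move=> Vv Ww; have Xv := VX Vv; have WIv := WI Vv; have WPv := WP Vv.
have Xw := WX Ww; have XJ := VX (VJ Ww); have XI := WX WIv; have XP := WX WPv.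
have := orthI Vv Ww; have := galP Vv Ww.
have := orthJ Ww WIv; have := orthJ Ww WPv.
rewrite !formBl ?formBr// ?(formC _ (I v)) ?(formC _ (P v)); try exact: subspaceB.
move=> *; lra.
Qed.

Lemma seminorm_ratio_P_le L v : 0 <= L ->
  (forall w, W w -> seminorm (w - J w) <= L * seminorm w) -> V v ->
  seminorm (v - P v) / seminorm (v - I v) <= Num.sqrt (1 + L ^+ 2).
Proof.
move=> L0 hL Vv; have Xv := VX Vv; have WIv := WI Vv; have WPv := WP Vv.
have WIP : W (I v - P v) by exact: (subspaceB sW).
have XI := WX WIv; have XP := WX WPv.
have [->|vI0] := eqVneq (seminorm (v - I v)) 0; first by rewrite invr0 mulr0 sqrtr_ge0.
have vI : 0 < seminorm (v - I v) by rewrite lt_neqAle eq_sym vI0 seminorm_ge0.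
rewrite ler_pdivrMr// -(ler_pXn2r (n := 2))// ?nnegrE ?mulr_ge0 ?sqrtr_ge0 ?seminorm_ge0//.
have s2 : Num.sqrt (1 + L ^+ 2) ^+ 2 = 1 + L ^+ 2 by rewrite sqr_sqrtr// addr_ge0 ?sqr_ge0.
rewrite sqr_seminorm_P// exprMn s2 mulrDl mul1r lerD2l -exprMn.
rewrite ler_pXn2r// ?nnegrE ?mulr_ge0 ?seminorm_ge0//.
have [->|d0] := eqVneq (seminorm (I v - P v)) 0; first by rewrite mulr_ge0 ?seminorm_ge0.
have d : 0 < seminorm (I v - P v) by rewrite lt_neqAle eq_sym d0 seminorm_ge0.
rewrite -(ler_pM2r d) -expr2 sqr_seminorm form_IP//.
have XwJ : X (I v - P v - J (I v - P v)).
  by apply: subspaceB => //; [exact: WX|exact/VX/VJ].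
apply: le_trans (cauchy_schwarz _ XwJ) _; first exact: subspaceB.
by rewrite [L * _]mulrC -mulrA ler_pM2l// hL.
Qed.

(** At [v = J w] one has [v - I v = J w - w], and [form_IP] bounds the defect [I v - P v] from
    below. If [J w - w] is null, then any [v] outside [W] will do, as every ratio is at least [1]. *)
Lemma seminorm_ratio_P_ge w : (exists2 v, V v & ~ W v) -> W w -> seminorm w != 0 ->
  exists2 v, V v /\ ~ W v &
    Num.sqrt (1 + (seminorm (w - J w) / seminorm w) ^+ 2) <=
    seminorm (v - P v) / seminorm (v - I v).
Proof.
move=> [v0 Vv0 Wv0] Ww w0.
have main v : V v -> ~ W v ->
    seminorm (w - J w) * seminorm (v - I v) <= seminorm w * seminorm (I v - P v) ->
    exists2 v, V v /\ ~ W v &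
    Num.sqrt (1 + (seminorm (w - J w) / seminorm w) ^+ 2) <=
    seminorm (v - P v) / seminorm (v - I v).
  move=> Vv Wv H; exists v => //.
  have vI : 0 < seminorm (v - I v).
    rewrite lt_neqAle seminorm_ge0 eq_sym andbT; apply/eqP => H0.
    by apply: Wv; exact: nullI.
  rewrite -(ler_pXn2r (n := 2))// ?nnegrE ?sqrtr_ge0 ?divr_ge0 ?seminorm_ge0//.
  rewrite [leLHS]sqr_sqrtr ?addr_ge0 ?sqr_ge0// [leRHS]expr_div_n sqr_seminorm_P//.
  rewrite mulrDl divff ?expf_neq0 ?gt_eqF// lerD2l -expr_div_n.
  rewrite ler_pXn2r// ?nnegrE ?divr_ge0 ?seminorm_ge0//.
  rewrite ler_pdivrMr ?lt_neqAle ?seminorm_ge0 1?eq_sym ?w0//.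
  by rewrite mulrAC ler_pdivlMr// [leRHS]mulrC.
have Xw := WX Ww; have VJw := VJ Ww; have XJ := VX VJw.
have WIJ := WI VJw; have XIJ := WX WIJ.
have [d0|d0] := eqVneq (seminorm (w - J w)) 0.
  by apply: (main v0) => //; rewrite d0 mul0r mulr_ge0 ?seminorm_ge0.
have XwJ : X (w - J w) by exact: subspaceB.
have vI z : X z -> a (J w - I (J w)) z = a (J w - w) z.
  move=> Xz; have -> : J w - I (J w) = (J w - w) - (I (J w) - w).
    by rewrite opprB addrA subrK.
  by rewrite formBl ?IJ ?subr0//; apply: subspaceB.
have dE : seminorm (J w - I (J w)) = seminorm (w - J w).
  have XB := subspaceB sX XJ Xw; have XB' := subspaceB sX XJ XIJ.
  by rewrite -[RHS]seminormN// opprB; congr Num.sqrt; rewrite vI// formC vI.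
apply: (main (J w)) => //.
  move=> WJ; move/eqP : d0; apply; rewrite -[LHS]seminormN// opprB; apply/eqP.
  by rewrite seminorm_eq0 orthJ//; exact: (subspaceB sW).
rewrite dE -expr2 sqr_seminorm.
have WP' := WP VJw.
have -> : a (w - J w) (w - J w) = a (- w) (I (J w) - P (J w)).
  have XIP : X (I (J w) - P (J w)) by apply: subspaceB => //; exact: WX.
  by rewrite formNl// formC form_IP// vI// -(opprB w) formNl// opprK.
rewrite -(seminormN Xw); apply: cauchy_schwarz; first exact: subspaceN.
by apply: subspaceB => //; exact: WX.
Qed.

(** Both suprema are the supremum of [sqrt (1 + (|w - J w| / |w|)^2)] over [w]: the one for [J] term
    by term, the one for [P] by the upper and the lower estimate of its ratios. *)
Lemma quasi_optimality_constants (S : set E) (L : R) : V `\` W !=set0 -> S !=set0 ->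
  (forall w, S w <-> W w /\ seminorm w != 0) ->
  (forall w, W w -> seminorm (w - J w) <= L * seminorm w) ->
  let Lambda := ereal_sup [set (seminorm (w - J w) / seminorm w)%:E | w in S] in
  ereal_sup [set (seminorm (v - P v) / seminorm (v - I v))%:E | v in V `\` W] =
    sqrte (1 + Lambda ^+ 2)%E /\
  sqrte (1 + Lambda ^+ 2)%E = ereal_sup [set (seminorm (J w) / seminorm w)%:E | w in S].
Proof.
move=> [v0 [Vv0 Wv0]] S0 SE hL Lambda.
have fL w : S w -> 0 <= seminorm (w - J w) / seminorm w <= L.
  move=> /SE[Ww w0]; have w_gt0 : 0 < seminorm w by rewrite lt_neqAle eq_sym w0 seminorm_ge0.
  by rewrite divr_ge0 ?seminorm_ge0//= ler_pdivrMr// hL.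
have [r [r0 fr supE sup_le]] := ereal_sup_sqrt S0 fL.
have -> : sqrte (1 + Lambda ^+ 2)%E = (Num.sqrt (1 + r ^+ 2))%:E by rewrite /Lambda supE.
split; apply/eqP; rewrite eq_le; apply/andP; split.
- apply: ge_ereal_sup => _ [v [Vv _] <-]; rewrite lee_fin.
  apply: seminorm_ratio_P_le => // w Ww.
  have [w0|w0] := eqVneq (seminorm w) 0.
    by apply: le_trans (hL _ Ww) _; rewrite w0 !mulr0.
  have w_gt0 : 0 < seminorm w by rewrite lt_neqAle eq_sym w0 seminorm_ge0.
  by rewrite -ler_pdivrMr//; apply: fr; apply/SE.
- apply: sup_le => w /SE[Ww w0].
  have [|v [Vv Wv] le] := seminorm_ratio_P_ge _ Ww w0; first by exists v0.
  apply: (@le_trans _ _ (seminorm (v - P v) / seminorm (v - I v))%:E).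
    by rewrite lee_fin.
  by apply: ereal_sup_ubound; exists v.
- apply: sup_le => w Sw; have [Ww w0] := (SE w).1 Sw.
  apply: ereal_sup_ubound; exists w => //.
  by rewrite seminorm_ratio_J.
- apply: ge_ereal_sup => _ [w Sw <-]; have [Ww w0] := (SE w).1 Sw.
  rewrite lee_fin seminorm_ratio_J//.
  apply: ler_wsqrtr; rewrite lerD2l lerXn2r// ?nnegrE//; last exact: fr.
  by have /andP[] := fL _ Sw.
Qed.

End quasi_optimality.
End semi_inner.

(** * Measure on the plane *)

Lemma rat_itv_between {R : realType} (x e : R) : 0 < e ->
  exists p q : rat, [/\ ratr p < x, x < ratr q, x - e < ratr p & ratr q < x + e].
Proof.
move=> e0.
have [p] := @rat_in_itvoo R (x - e) x (ltac:(by rewrite ltrBlDr ltrDl)).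
have [q] := @rat_in_itvoo R x (x + e) (ltac:(by rewrite ltrDl)).
rewrite !in_itv/= => /andP[? ?] /andP[? ?].
by exists p, q.
Qed.

Section plane.
Context {R : realType}.
Local Notation leb := (@lebesgue_measure R).
Local Notation leb2 := (leb \x leb)%E.
Implicit Types U : set (R * R).

Definition rectangle (a b c d : R) : set (R * R) := `]a, b[%classic `*` `]c, d[%classic.

Definition closed_rectangle (a b c d : R) : set (R * R) := `[a, b]%classic `*` `[c, d]%classic.

Lemma rectangle_sub_closed a b c d : rectangle a b c d `<=` closed_rectangle a b c d.
Proof.
move=> x [/=]; rewrite !in_itv/= => /andP[/ltW ? /ltW ?] /andP[/ltW ? /ltW ?].
by split; rewrite /= in_itv/=; apply/andP.
Qed.

Lemma measurable_rectangle a b c d :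
  measurable (rectangle a b c d : set (plane R)).
Proof. by apply: measurableX; exact: measurable_itv. Qed.

(** Requiring the closed rectangle to lie in [U] makes the bump functions of the rectangle test
    functions on [U]. *)
Lemma open_rat_rectangle U : open U -> U =
  \bigcup_(q in [set q : (rat * rat) * (rat * rat) |
      closed_rectangle (ratr q.1.1) (ratr q.1.2) (ratr q.2.1) (ratr q.2.2) `<=` U])
    rectangle (ratr q.1.1) (ratr q.1.2) (ratr q.2.1) (ratr q.2.2).
Proof.
move=> oU; apply/seteqP; split => [x Ux|x [q qU] [/= x1 x2]]; last first.
  apply: qU; split => /=.
    by move: x1; rewrite !in_itv/= => /andP[/ltW -> /ltW ->].
  by move: x2; rewrite !in_itv/= => /andP[/ltW -> /ltW ->].
have /nbhs_ballP[e /= e0 xeU] : nbhs x U by exact: open_nbhs_nbhs.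
have [p1 [q1 [? ? ? ?]]] := rat_itv_between x.1 e0.
have [p2 [q2 [? ? ? ?]]] := rat_itv_between x.2 e0.
exists ((p1, q1), (p2, q2)) => /=; last first.
  by split; rewrite /= in_itv/=; apply/andP; split.
move=> y [/=]; rewrite !in_itv/= => /andP[? ?] /andP[? ?]; apply: xeU.
by split; rewrite /ball/= ltr_norml; apply/andP; split; lra.
Qed.

Lemma open_measurable_plane U : open U ->
  measurable (U : set (plane R)).
Proof.
move=> /open_rat_rectangle ->; rewrite bigcup_mkcond.
apply: countable_bigcupT_measurable => // q.
by case: ifPn => _; [exact: measurable_rectangle|exact: measurable0].
Qed.

Lemma continuous_measurable_plane (f : R * R -> R) : continuous f ->
  measurable_fun [set: plane R] (f : _ -> measurableTypeR R).
Proof.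
move=> cf; apply: (measurability _ (RGenOpens.measurableE R)) => _ [_ [a [b ->] <-]].
rewrite setTI; apply: open_measurable_plane; apply: open_comp; last exact: interval_open.
by move=> x _; exact: cf.
Qed.

Lemma continuous_affine2 (a b c : R) : continuous (fun x : R * R => a * x.1 + b * x.2 + c).
Proof.
move=> x; apply: cvgD; last exact: cvg_cst.
by apply: cvgD; apply: cvgM; try exact: cvg_cst; [exact: cvg_fst|exact: cvg_snd].
Qed.

Lemma leb2_setX (A B : set (measurableTypeR R)) : measurable A -> measurable B ->
  leb2 (A `*` B) = (leb A * leb B)%E.
Proof. exact: product_measure1E. Qed.

(** A line meets almost every vertical line in at most one point, or lies in a
    vertical line. *)
Lemma line_negligible (a b c : R) : (a != 0) || (b != 0) ->
  leb2.-negligible [set x : R * R | a * x.1 + b * x.2 + c = 0].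
Proof.
move=> ab.
have cf := @continuous_affine2 a b c.
have mL : measurable ([set x : R * R | a * x.1 + b * x.2 + c = 0] :
    set (plane R)).
  rewrite (_ : mkset _ = ~` [set x | a * x.1 + b * x.2 + c != 0]); last first.
    apply/seteqP; split => x /=; first by move=> ->; apply/negP; rewrite negbK.
    by move=> /negP; rewrite negbK => /eqP.
  apply: measurableC; apply: open_measurable_plane.
  apply: (@open_comp _ _ _ [set y | y != 0]); first by move=> x _; exact: cf.
  exact: open_neq.
have [b0|b0] := eqVneq b 0.
  have a0 : a != 0 by move: ab; rewrite b0 eqxx orbF.
  apply: (@negligibleS _ _ _ leb2 ([set - c / a] `*` setT)).
    move=> x /=; rewrite b0 mul0r addr0 => /eqP; rewrite addr_eq0 => /eqP E.
    by split => //=; rewrite -E; field.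
  apply/negligibleP; first by apply: measurableX.
  by apply: etrans (leb2_setX _ _) _ => //; rewrite lebesgue_measure_set1 mul0e.
apply/negligibleP => //; rewrite /product_measure1/=.
apply: integral0_eq => x _ /=; rewrite (_ : xsection _ _ = [set - (a * x + c) / b]).
  exact: lebesgue_measure_set1.
apply/seteqP; split=> y; rewrite /xsection/= inE/=.
  by move=> /eqP; rewrite addrAC addr_eq0 => /eqP ->; field.
by move=> ->; field.
Qed.

Lemma bounded_set_square (U : set (R * R)) : bounded_set U ->
  exists2 M : R, 0 < M & U `<=` [set x | `|x.1| < M /\ `|x.2| < M].
Proof.
move=> [M [Mr HM]]; pose B := `|M| + 1.
have B0 : 0 < B by rewrite ltr_wpDl.
exists (B + 1); first by rewrite ltr_wpDr.
move=> x Ux; have := HM B (ltac:(rewrite (le_lt_trans (ler_norm M))// ltrDl//)) x Ux.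
rewrite /= prod_normE ge_max => /andP[? ?]; split; rewrite (le_lt_trans (y := B)) ?ltrDl//.
Qed.

Lemma rectangle_lty a b c d : (leb2 (rectangle a b c d) < +oo)%E.
Proof.
have E := leb2_setX (measurable_itv `]a, b[) (measurable_itv `]c, d[).
refine (eq_ind_r (fun z => z < +oo)%E _ E).
rewrite !lebesgue_measure_itv/= !lte_fin; case: ifPn => _; last by rewrite mul0e ltry.
case: ifPn => _; last by rewrite mule0 ltry.
by rewrite -!EFinD -EFinM ltry.
Qed.

Lemma bounded_measure_lty (U : set (R * R)) : measurable (U : set (plane R)) ->
  bounded_set U -> (leb2 U < +oo)%E.
Proof.
move=> mU /bounded_set_square[M M0 UM].
have sub : U `<=` rectangle (- M) M (- M) M.
  by move=> x /UM[]; rewrite !ltr_norml /rectangle => H1 H2; split; rewrite /= in_itv.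
apply: le_lt_trans (le_measure leb2 _ _ sub) (rectangle_lty _ _ _ _); rewrite ?inE//.
exact: measurable_rectangle.
Qed.
End plane.

(** * Smooth functions and bumps *)

Section directional.
Context {R : realType}.
Implicit Types (f g : R * R -> R) (x v : R * R).

(** Reduces derivatives in the plane to the calculus of one variable. *)
Lemma is_derive_line f x v df :
  is_derive (0 : R) (1 : R) (fun t : R => f (t *: v + x)) df <-> is_derive x v f df.
Proof.
have E : (fun h : R => h^-1 *: 
    (((fun t : R => f (t *: v + x)) \o shift 0) (h *: 1) - f (0 *: v + x)))
       = (fun h : R => h^-1 *: ((f \o shift x) (h *: v) - f x)).
  by apply/funext => h /=; rewrite addr0 [h *: 1]mulr1 scale0r add0r.
split=> -[d1 d2]; split.
- by rewrite /derivable -E; exact: d1.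
- by rewrite /derive -E; exact: d2.
- by rewrite /derivable E; exact: d1.
- by rewrite /derive E; exact: d2.
Qed.

Definition coord (i : 'I_2) x : R := if i == 0 then x.1 else x.2.

Lemma coordD i x y : coord i (x + y) = coord i x + coord i y.
Proof. by rewrite /coord; case: ifP. Qed.
Lemma coordZ i (c : R) x : coord i (c *: x) = c * coord i x.
Proof. by rewrite /coord; case: ifP. Qed.

Lemma continuous_coord i : continuous (coord i).
Proof.
move=> x; rewrite /coord; case: (i == 0); [apply: cvg_fst|apply: cvg_snd].
Qed.

Lemma is_derive_coord_comp (g : R -> R) i (c b : R) x v dg :
  is_derive (c * coord i x + b) 1 g dg ->
  is_derive x v (fun y => g (c * coord i y + b)) (c * coord i v * dg).
Proof.
move=> dgx; apply/is_derive_line.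
have -> : (fun t : R => g (c * coord i (t *: v + x) + b)) =
  g \o (fun t : R => (c * coord i v) *: t + (c * coord i x + b)).
  by apply/funext => t /=; rewrite coordD coordZ /GRing.scale/=; congr g; ring.
have H : is_derive (0 : R) 1 (fun t : R => (c * coord i v) *: t + (c * coord i x + b))
   ((c * coord i v) *: 1 + 0).
  by apply: is_deriveD; apply: is_deriveZ.
have dg0 : is_derive ((c * coord i v) *: (0 : R) + (c * coord i x + b)) 1 g dg.
  by rewrite scaler0 add0r.
apply: (is_derive_eq (@is_derive1_comp _ g _ 0 _ _ dg0 H)).
by rewrite /GRing.scale/= mulr1 addr0 mulrC.
Qed.
End directional.

Section Ck.
Context {R : realType}.
Implicit Types (f g : R * R -> R).

(** Differentiability up to order [n] along the axes, in a form that is proved by induction on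
    [n] for sums and products. *)
Fixpoint Ck n f : Prop := continuous f /\
  if n is n.+1 then forall i, (forall x, derivable f x (unit_vec i)) /\
    Ck n (fun x => 'D_(unit_vec i) f x) else True.

Lemma Ck_continuous n f : Ck n f -> continuous f. Proof. by case: n => [|n] []. Qed.

Lemma CkS n f : Ck n.+1 f -> Ck n f.
Proof.
elim: n f => [|n IH] f [cf H]; split => // i; have [df Cf] := H i.
by split => //; exact: IH.
Qed.

Lemma continuousD f g : continuous f -> continuous g -> continuous (f \+ g).
Proof. by move=> cf cg x; apply: cvgD; [exact: cf|exact: cg]. Qed.
Lemma continuousM f g : continuous f -> continuous g -> continuous (f \* g).
Proof. by move=> cf cg x; apply: cvgM; [exact: cf|exact: cg]. Qed.

Lemma CkD n f g : Ck n f -> Ck n g -> Ck n (f \+ g).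
Proof.
elim: n f g => [|n IH] f g [cf Hf] [cg Hg]; split => //; try exact: continuousD.
move=> i; have [df Cf] := Hf i; have [dg Cg] := Hg i; split.
  by move=> x; exact: derivableD.
rewrite (_ : (fun x => _) = (fun x => 'D_(unit_vec i) f x) \+ (fun x => 'D_(unit_vec i) g x)).
  exact: IH.
by apply/funext => x; rewrite [LHS]deriveD.
Qed.

Lemma CkM n f g : Ck n f -> Ck n g -> Ck n (f \* g).
Proof.
elim: n f g => [|n IH] f g Cnf Cng.
  by case: Cnf Cng => cf _ [cg _]; split => //; exact: continuousM.
split; first by apply: continuousM; apply: Ck_continuous; eassumption.
move=> i; have [df Cf] := Cnf.2 i; have [dg Cg] := Cng.2 i; split.
  by move=> x; exact: derivableM.
rewrite (_ : (fun x => _) =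
  (f \* (fun x => 'D_(unit_vec i) g x)) \+ (g \* (fun x => 'D_(unit_vec i) f x))).
  by apply: CkD; apply: IH => //; exact: CkS.
by apply/funext => x; rewrite [LHS]deriveM.
Qed.

Lemma Ck_cst n (c : R) : Ck n (cst c).
Proof.
elim: n c => [|n IH] c; split => //; try exact: cst_continuous.
move=> i; split; first by move=> x; exact: derivable_cst.
rewrite (_ : (fun x => _) = cst 0); first exact: IH.
by apply/funext => x; rewrite [LHS]derive_cst.
Qed.

(** [Ck] peels derivatives from the inside, [pder] from the outside. *)
Lemma pder_rcons s i f : pder (rcons s i) f = pder s (fun x => 'D_(unit_vec i) f x).
Proof. by rewrite /pder foldr_rcons. Qed.

Lemma Ck_smooth f : (forall n, Ck n f) -> smooth f.
Proof.
move=> Cf s.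
elim/last_ind: s f Cf => [|s i IH] f Cf.
  by split; [exact: Ck_continuous (Cf 0%N)|move=> i x; exact: ((Cf 1%N).2 i).1].
by rewrite pder_rcons; apply: IH => n; exact: ((Cf n.+1).2 i).2.
Qed.
End Ck.

Section flat.
Context {R : realType}.
Implicit Types (t h : R) (k n : nat).

(** At [k = 0] this is the standard smooth function that is flat at the origin. The family is
    closed under differentiation up to linear combinations, which is why it has a parameter. *)
Definition flat k t : R := if 0 < t then t^-1 ^+ k * expR (- t^-1) else 0.

Lemma flat_ge0 k t : 0 <= flat k t.
Proof.
by rewrite /flat; case: ifP => // t0; rewrite mulr_ge0 ?expR_ge0// exprn_ge0// invr_ge0 ltW.
Qed.

(** Only this decay matters: [e^u >= u^(k+1) / (k+1)!] at [u = 1/t]. *)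
Lemma flat_le k t : 0 <= t -> flat k t <= (k.+1)`!%:R * t.
Proof.
rewrite /flat le_eqVlt => /predU1P[<-|t0]; first by rewrite ltxx mulr0.
rewrite t0 expRN ler_pdivrMr ?expR_gt0//.
have f0 : 0 < k.+1`!%:R :> R by rewrite ltr0n fact_gt0.
have : t^-1 ^+ k.+1 / k.+1`!%:R <= expR t^-1.
  apply: le_trans (expR_ge1Dxn k _); last by rewrite invr_ge0 ltW.
  by rewrite ler_wpDl.
rewrite ler_pdivrMr// => H.
have -> : t^-1 ^+ k = t * t^-1 ^+ k.+1 by rewrite exprS mulrA divff ?mul1r// gt_eqF.
by rewrite mulrAC [leRHS]mulrC ler_pM2l// mulrC.
Qed.

Lemma flat_div k t : t^-1 * flat k t = flat k.+1 t.
Proof. by rewrite /flat; case: ifP; rewrite ?mulr0// mulrA exprS. Qed.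

(** At the origin the difference quotient of [flat k] is [flat k.+1], which tends to zero by
    [flat_le]. *)
Lemma is_derive_flat k t :
  is_derive t 1 (flat k) (- k%:R * flat k.+1 t + flat k.+2 t).
Proof.
have [t0|t0|->] := ltgtP t 0.
- rewrite /flat !ltNge (ltW t0)/= mulr0 addr0.
  apply: (@near_eq_is_derive _ _ _ (cst 0)).
  near=> z; rewrite ifF//; apply/negbTE; rewrite -leNgt ltW//.
  by near: z; exact: lt_nbhsl.
- rewrite /flat t0.
  apply: (@near_eq_is_derive _ _ _ ((fun z => z^-1 ^+ k) \* (fun z => expR (- z^-1)))).
    near=> z; rewrite ifT//; near: z; exact: lt_nbhsr.
  have dV : is_derive t 1 (fun z : R => z^-1) (- t ^- 2 *: 1).
    by apply: is_deriveV => //; rewrite gt_eqF.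
  have d1 : is_derive t 1 (fun z => z^-1 ^+ k) ((k%:R * t^-1 ^+ k.-1) *: (- t ^- 2 *: 1)).
    by rewrite -[X in is_derive _ _ X _]exprfctE; exact: is_deriveX.
  have d2 : is_derive t 1 (fun z => expR (- z^-1)) (expR (- t^-1) * - (- t ^- 2 *: 1)).
    by apply: (@is_derive1_comp _ expR (fun z => - z^-1)).
  apply: (is_derive_eq (is_deriveM d1 d2)); rewrite /GRing.scale/=.
  case: k {d1} => [|k] /=; 
    first by rewrite !expr0 !mul0r !mulr0 !addr0 oppr0 mul0r add0r; field; rewrite gt_eqF.
  by rewrite !exprS; field; rewrite gt_eqF.
- have E k' : flat k' 0 = 0 by rewrite /flat ltxx.
  rewrite !E mulr0 addr0.
  have H : (fun h => h^-1 *: ((flat k \o shift 0) (h *: 1) - flat k 0)) @ 0^' --> (0 : R).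
    have -> : (fun h => h^-1 *: ((flat k \o shift 0) (h *: 1) - flat k 0)) = flat k.+1.
      by apply/funext => h /=; rewrite E subr0 addr0 [h *: 1]mulr1 [LHS]flat_div.
    apply: (@squeeze_cvgr _ _ _ _ (cst 0) (fun h => k.+2`!%:R * `|h|)).
    + near=> h; rewrite flat_ge0/=.
      have [h0|h0] := leP 0 h; first by rewrite (ger0_norm h0) flat_le.
      by rewrite /flat ltNge (ltW h0)/= mulr_ge0.
    + exact: cvg_cst.
    + rewrite -[X in _ --> X](mulr0 k.+2`!%:R); apply: cvgM; first exact: cvg_cst.
      rewrite -[X in _ --> X](@normr0 _ R); apply: cvg_norm.
      exact: cvg_within.
  by split; [apply/cvg_ex; exists 0|exact: cvg_lim].
Unshelve. all: by end_near.
Qed.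

Lemma continuous_flat k : continuous (flat k).
Proof.
move=> t; apply: differentiable_continuous; apply/derivable1_diffP.
by have [] := is_derive_flat k t.
Qed.

Lemma flat_Ck n k i c b : Ck n (fun x : R * R => flat k (c * coord i x + b)).
Proof.
have cf k' : continuous (fun x : R * R => flat k' (c * coord i x + b)).
  move=> x; apply: (@continuous_comp _ _ _ (fun x => c * coord i x + b) (flat k'));
    last exact: continuous_flat.
  apply: cvgD; last exact: cvg_cst.
  by apply: cvgM; [exact: cvg_cst|exact: continuous_coord].
elim: n k => [|n IH] k; split => // j.
have D (x : R * R) := @is_derive_coord_comp R (flat k) i c b x (unit_vec j) _
  (is_derive_flat k (c * coord i x + b)).
split; first by move=> x; have [] := D x.
rewrite (_ : (fun x => _) = cst (c * coord i (unit_vec j)) \*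
  ((cst (- k%:R) \* (fun x => flat k.+1 (c * coord i x + b))) \+
   (fun x => flat k.+2 (c * coord i x + b)))).
  by apply: CkM; [exact: Ck_cst|apply: CkD => //; apply: CkM => //; exact: Ck_cst].
by apply/funext => x; have [_ ->] := D x.
Qed.

Lemma flat0_le1 t : flat 0 t <= 1.
Proof.
rewrite /flat; case: ifP => // t0; rewrite mul1r expR_le1.
by rewrite oppr_le0 invr_ge0 ltW.
Qed.

Lemma flat0_gt0 t : (0 < flat 0 t) = (0 < t).
Proof. by rewrite /flat; case: ifP; rewrite ?ltxx// mul1r expR_gt0. Qed.

(** Dilating the flat function turns it into the Heaviside function. *)
Lemma cvg_flat0 t : flat 0 (n%:R * t) @[n --> \oo] --> ((0 < t)%R%:R : R).
Proof.
have [t0|t0] := ltP 0 t; last first.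
  rewrite [X in X @ _](_ : _ = cst 0); first exact: cvg_cst.
  apply/funext => n; rewrite /flat ifF//; apply/negbTE; rewrite -leNgt.
  by rewrite mulr_ge0_le0.
have H : expR (- (n%:R * t)^-1) @[n --> \oo] --> (1 : R).
  have cE : {for (0 : R), continuous (fun z : R => expR (- z))}.
    by apply: continuous_comp; [exact: opp_continuous|exact: continuous_expR].
  have H0 : (n%:R * t)^-1 @[n --> \oo] --> (0 : R).
    under eq_fun do rewrite invfM.
    rewrite -(mul0r t^-1); apply: cvgM; last exact: cvg_cst.
    by rewrite -cvg_shiftS; exact: cvg_harmonic.
  by have := continuous_cvg _ cE H0; rewrite /= oppr0 expR0; apply; exact: eventually_filter.
apply: cvg_trans H; apply: near_eq_cvg.
near=> n; rewrite /flat ifT ?mul1r// mulr_gt0// ltr0n; near: n; exact: nbhs_infty_gt.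
Unshelve. all: by end_near.
Qed.
End flat.

Section bump.
Context {R : realType}.
Variables (a b c d : R).

(** For [n > 0] these smooth functions are positive exactly on the rectangle [(a, b) x (c, d)];
    as [n] grows they increase to its indicator function. *)
Definition bump (n : nat) : R * R -> R :=
  let slope i s e := fun x => flat 0 (s * coord i x + e) in
  (slope 0 n%:R (- n%:R * a) \* slope 0 (- n%:R) (n%:R * b)) \*
  (slope 1 n%:R (- n%:R * c) \* slope 1 (- n%:R) (n%:R * d)).

Lemma bumpE n x : bump n x =
  flat 0 (n%:R * (x.1 - a)) * flat 0 (n%:R * (b - x.1)) *
  (flat 0 (n%:R * (x.2 - c)) * flat 0 (n%:R * (d - x.2))).
Proof. by rewrite /bump/= /coord/= !mulrBr !mulNr ![- _ + _]addrC. Qed.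

Lemma bump_itv n x : 0 <= bump n x <= 1.
Proof.
rewrite /bump/= !mulr_ge0 ?flat_ge0//=.
by rewrite !mulr_ile1 ?mulr_ge0 ?flat_ge0 ?flat0_le1.
Qed.

Lemma bump_supp n x : bump n x != 0 -> rectangle a b c d x.
Proof.
rewrite bumpE !mulf_eq0 !negb_or -!andbA.
have P y : flat 0 (n%:R * y) != 0 -> 0 < y.
  move=> H; have : 0 < flat 0 (n%:R * y) by rewrite lt_neqAle eq_sym H flat_ge0.
  rewrite flat0_gt0; case: n {H} => [|n]; first by rewrite mul0r ltxx.
  by rewrite pmulr_rgt0.
move=> /and4P[/P + /P + /P + /P]; rewrite !subr_gt0 => *.
by split; rewrite /= in_itv/=; apply/andP.
Qed.

Lemma bump_cvg x : bump n x @[n --> \oo] --> (\1_(rectangle a b c d) x : R).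
Proof.
under eq_fun do rewrite bumpE.
have -> : (\1_(rectangle a b c d) x : R) =
    (0 < x.1 - a)%R%:R * (0 < b - x.1)%R%:R * ((0 < x.2 - c)%R%:R * (0 < d - x.2)%R%:R).
  rewrite -!natrM !mulnb indicE; congr (nat_of_bool _)%:R; apply/idP/idP.
    by rewrite inE => -[/=]; rewrite !in_itv/= !subr_gt0 => /andP[-> ->] /andP[-> ->].
  rewrite !subr_gt0 => /andP[/andP[? ?] /andP[? ?]].
  by rewrite inE; split; rewrite /= in_itv/=; apply/andP.
by apply: cvgM; apply: cvgM; exact: cvg_flat0.
Qed.

Lemma bump_smooth n : smooth (bump n).
Proof. by apply: Ck_smooth => k; apply: CkM; apply: CkM; exact: flat_Ck. Qed.

Lemma bump_test_function n U : closed_rectangle a b c d `<=` U -> test_function U (bump n).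
Proof.
move=> QU; have cQ : compact (closed_rectangle a b c d).
  by apply: compact_setX; exact: segment_compact.
have sub : closure [set x | bump n x != 0] `<=` closed_rectangle a b c d.
  have cl : closed (closed_rectangle a b c d).
    by apply: compact_closed => //; exact: norm_hausdorff.
  rewrite [X in _ `<=` X](closure_id _).1//; apply: closure_subset => x /bump_supp.
  exact: rectangle_sub_closed.
split; first exact: bump_smooth.
  exact: (subclosed_compact (@closed_closure _ _) cQ sub).
exact: subset_trans sub QU.
Qed.
End bump.

(** * The fundamental lemma of the calculus of variations *)

(** The sets whose preimage carries a vanishing integral form a Dynkin system. Taking preimages
    under a projection allows to treat the two coordinates one after the other. *)
Lemma integral0_preimage_dynkin d d' (T : measurableType d) (T' : measurableType d')
    (R : realType) (mu : {measure set T -> \bar R}) (p : T -> T') (Q : set T) (g : T -> R)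
    (G : set (set T')) :
  measurable_fun setT p -> measurable Q -> mu.-integrable Q (EFin \o g) ->
  @measurable _ T' = <<s G >> -> setI_closed G ->
  (\int[mu]_(x in Q) (g x)%:E = 0)%E ->
  (forall A, G A -> \int[mu]_(x in p @^-1` A `&` Q) (g x)%:E = 0)%E ->
  forall A, measurable A -> (\int[mu]_(x in p @^-1` A `&` Q) (g x)%:E = 0)%E.
Proof.
move=> mp mQ ig GE GI gQ0 gG0 A mA.
have mpQ B : measurable B -> measurable (p @^-1` B `&` Q).
  by move=> mB; apply: measurableI => //; rewrite -[X in measurable X]setTI; exact: mp.
have ipQ B : measurable B -> mu.-integrable (p @^-1` B `&` Q) (EFin \o g).
  by move=> mB; apply: (integrableS mQ) => //; exact: mpQ.
apply: (dynkin_induction (P := fun A => \int[mu]_(x in p @^-1` A `&` Q) (g x)%:E = 0)%E GE GI).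
- by rewrite preimage_setT setTI.
- by [].
- move=> B mB gB0.
  have QE : Q = (p @^-1` B `&` Q) `|` (p @^-1` (~` B) `&` Q).
    by rewrite -setIUl preimage_setC setUv setTI.
  move: gQ0; rewrite {1}QE integral_setU_EFin//.
  + by rewrite gB0 add0e.
  + exact: mpQ.
  + by apply: mpQ; exact: measurableC.
  + by rewrite -QE; apply/measurable_EFinP; exact: measurable_int ig.
  + apply/disj_setPS => x [[/= xB _] [xB' _]]; exact: xB'.
- move=> F mF tF gF0.
  rewrite preimage_bigcup setI_bigcupl integral_bigcup.
  + by rewrite eseries0// => i _ _; exact: gF0.
  + move=> i j _ _ [x [[/= xi _] [xj _]]]; apply: (tF i j) => //; by exists (p x).
  + by move=> k; exact: mpQ.
  + rewrite -setI_bigcupl; apply: (integrableS mQ) => //.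
    apply: measurableI => //; rewrite -preimage_bigcup -[X in measurable X]setTI.
    by apply: mp => //; exact: bigcup_measurable.
- by rewrite -GE.
Qed.

Section fundamental_lemma.
Context {R : realType}.
Local Notation leb := (@lebesgue_measure R).
Local Notation leb2 := (leb \x leb)%E.
Variables (U : set (R * R)) (g : R * R -> R).
Hypotheses (oU : open U) (ig : leb2.-integrable U (EFin \o g)).
Hypothesis g0 : forall phi, test_function U phi -> \int[leb2]_(x in U) (g x * phi x) = 0.

Let mU : measurable (U : set (plane R)) := open_measurable_plane oU.

Lemma test_function_continuous V (phi : R * R -> R) : test_function V phi -> continuous phi.
Proof. by move=> [/(_ [::])[]]. Qed.

(** Dominated convergence along the bump functions of the rectangle. *)
Lemma integral0_rectangle a b c d : closed_rectangle a b c d `<=` U ->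
  (\int[leb2]_(x in rectangle a b c d) (g x)%:E = 0)%E.
Proof.
move=> QU.
have mQ := measurable_rectangle a b c d.
have QsubU : rectangle a b c d `<=` U := subset_trans (@rectangle_sub_closed _ a b c d) QU.
have mg : measurable_fun U (g : plane R -> _).
  by apply/measurable_EFinP; exact: measurable_int ig.
have mbump n : measurable_fun setT (bump a b c d n : plane R -> measurableTypeR R).
  apply: continuous_measurable_plane.
  exact: test_function_continuous (bump_test_function n QU).
have mgb n : measurable_fun U (bump a b c d n : plane R -> _) := measurable_funTS (mbump n).
have := @dominated_convergence _ (plane R) R leb2 U mU
  (fun n x => (g x * bump a b c d n x)%:E) (fun x => (g x * \1_(rectangle a b c d) x)%:E)
  (fun x => `|g x|%:E).
case.
- by move=> n; apply/measurable_EFinP; exact: (measurable_funM mg (mgb n)).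
- apply/measurable_EFinP; apply: (measurable_funM mg).
  exact: measurable_indic.
- apply: aeW => x Ux; apply: cvg_EFin; first by apply: nearW => n.
  by apply: cvgM; [exact: cvg_cst|exact: bump_cvg].
- exact: (integrable_abse ig).
- apply: aeW => x n Ux; rewrite /= lee_fin normrM ler_piMr//.
  by have /andP[? ?] := bump_itv a b c d n x; rewrite ger0_norm.
move=> i1 _ /=.
have -> : (fun n => \int[leb2]_(x in U) (g x * bump a b c d n x)%:E)%E = cst 0%E.
  apply/funext => n.
  have H := g0 (bump_test_function n QU).
  have fin : (\int[leb2]_(x in U) (g x * bump a b c d n x)%:E)%E \is a fin_num.
    apply: integrable_fin_num => //.
    apply: (le_integrable mU _ _ ig).
      by apply/measurable_EFinP; exact: (measurable_funM mg (mgb n)).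
    move=> x Ux; rewrite /= lee_fin normrM ler_piMr//.
    by have /andP[? ?] := bump_itv a b c d n x; rewrite ger0_norm.
  by rewrite -[LHS]fineK// [fine _]H.
move=> H0; have := cvg_lim (@ereal_hausdorff R) H0; rewrite lim_cst// => I0.
apply: etrans (esym (I0 _)).
have := @integral_mkcondr _ (plane R) R leb2 U (rectangle a b c d) (EFin \o g).
rewrite (setIidr QsubU) => ->.
apply: eq_integral => x _; rewrite patchE indicE; case: ifPn => _ //=.
  by rewrite mulr1.
by rewrite mulr0.
Qed.

Lemma rectangle_cut (a b c d x y : R) :
  fst @^-1` `]x, +oo[%classic `&` (snd @^-1` `]y, +oo[%classic `&` rectangle a b c d) =
  rectangle (Num.max a x) b (Num.max c y) d.
Proof.
apply/seteqP; split => z /=; rewrite /rectangle/= !in_itv/= !andbT !gt_max.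
  by move=> [-> [-> [/andP[-> ->] /andP[-> ->]]]].
by move=> [/= /andP[/andP[-> ->] ->] /andP[/andP[-> ->] ->]].
Qed.

(** The half-lines generate the Borel sets of the line: a first Dynkin argument passes from
    quadrants to [A x (y, oo)], a second one to [A x B], and a third one to all measurable sets. *)
Lemma integral0_measurable a b c d (E : set (plane R)) : closed_rectangle a b c d `<=` U ->
  measurable E -> (\int[leb2]_(x in E `&` rectangle a b c d) (g x)%:E = 0)%E.
Proof.
move=> QU mE; set Q := rectangle a b c d.
have mQ : measurable (Q : set (plane R)) := measurable_rectangle a b c d.
have QsubU : Q `<=` U := subset_trans (@rectangle_sub_closed _ a b c d) QU.
have igS (D : set (plane R)) : measurable D -> D `<=` Q -> leb2.-integrable D (EFin \o g).
  by move=> mD DQ; apply: (integrableS mU) => //; exact: subset_trans QsubU.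
have GE := RGenOInfty.measurableE R.
have GI : setI_closed (@RGenOInfty.G R).
  move=> _ _ [x ->] [y ->]; exists (Num.max x y).
  by apply/seteqP; split => z /=; rewrite !in_itv/= !andbT gt_max; [move=> [-> ->]|move=> /andP[]].
have cut0 x y : (\int[leb2]_(z in fst @^-1` `]x, +oo[%classic `&`
     (snd @^-1` `]y, +oo[%classic `&` Q)) (g z)%:E = 0)%E.
  rewrite rectangle_cut; apply: integral0_rectangle; apply: subset_trans QU => z [/=].
  rewrite !in_itv/= !ge_max => /andP[/andP[? _] ?] /andP[/andP[? _] ?].
  by split; rewrite /= in_itv/=; apply/andP.
have cutE y : (snd @^-1` `]y, +oo[%classic `&` Q) =
    fst @^-1` `]a, +oo[%classic `&` (snd @^-1` `]y, +oo[%classic `&` Q).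
  apply/seteqP; split => z /=; last by case.
  by rewrite /Q/rectangle/= !in_itv/= => -[-> [/andP[-> ->] ->]].
have cutQ : Q = (snd @^-1` `]c, +oo[%classic `&` Q).
  apply/seteqP; split => z /=; last by case.
  by rewrite /Q/rectangle/= !in_itv/= => -[-> /andP[-> ->]].
have msnd (B : set (measurableTypeR R)) : measurable B -> measurable (snd @^-1` B : set (plane R)).
  by move=> mB; rewrite -[X in measurable X]setTI; exact: measurable_snd.
have mfst (B : set (measurableTypeR R)) : measurable B -> measurable (fst @^-1` B : set (plane R)).
  by move=> mB; rewrite -[X in measurable X]setTI; exact: measurable_fst.
have mitv y : measurable (`]y, +oo[%classic : set (measurableTypeR R)) by exact: measurable_itv.
have step1 (A : set (measurableTypeR R)) y : measurable A ->
    (\int[leb2]_(z in fst @^-1` A `&` (snd @^-1` `]y, +oo[%classic `&` Q)) (g z)%:E = 0)%E.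
  apply: (integral0_preimage_dynkin _ _ _ GE GI).
  - exact: measurable_fst.
  - by apply: measurableI => //; exact: msnd.
  - by apply: igS; [apply: measurableI => //; exact: msnd|exact: subIsetr].
  - by rewrite cutE.
  - by move=> _ [x ->].
have step2 (A B : set (measurableTypeR R)) : measurable A -> measurable B ->
    (\int[leb2]_(z in snd @^-1` B `&` (fst @^-1` A `&` Q)) (g z)%:E = 0)%E.
  move=> mA; apply: (integral0_preimage_dynkin _ _ _ GE GI).
  - exact: measurable_snd.
  - by apply: measurableI => //; exact: mfst.
  - by apply: igS; [apply: measurableI => //; exact: mfst|exact: subIsetr].
  - by rewrite cutQ; exact: step1.
  - by move=> _ [y ->]; rewrite setICA; exact: step1.
have := @integral0_preimage_dynkin _ _ _ (plane R) R leb2 id Q g _ _ mQ _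
  (measurable_prod_measurableType _ _).
apply => //.
- exact: igS.
- move=> _ _ [A1 mA1 [B1 mB1 <-]] [A2 mA2 [B2 mB2 <-]].
  exists (A1 `&` A2); first exact: measurableI.
  exists (B1 `&` B2); first exact: measurableI.
  by rewrite setXI.
- by have := integral0_rectangle QU.
- move=> _ [A mA [B mB <-]].
  have -> : id @^-1` (A `*` B) `&` Q = snd @^-1` B `&` (fst @^-1` A `&` Q).
    by apply/seteqP; split => z /=; [move=> [[? ?] ?]|move=> [? [? ?]]].
  exact: step2.
Qed.

(** [U] is a countable union of rectangles, and the integral of [g] over every measurable subset of
    one of them vanishes. *)
Theorem fundamental_lemma : eqL2 U g (cst 0).
Proof.
pose Q (q : (rat * rat) * (rat * rat)) : set (R * R) :=
  rectangle (ratr q.1.1) (ratr q.1.2) (ratr q.2.1) (ratr q.2.2).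
pose K (q : (rat * rat) * (rat * rat)) : set (R * R) :=
  closed_rectangle (ratr q.1.1) (ratr q.1.2) (ratr q.2.1) (ratr q.2.2).
have gQ q : K q `<=` U -> ae_eq leb2 (Q q) (EFin \o g) (cst 0%E).
  move=> KU; apply: integral_ae_eq.
  - exact: measurable_rectangle.
  - apply: (integrableS mU) => //; first exact: measurable_rectangle.
    by rewrite (open_rat_rectangle oU) => x Qx; exists q.
  - exact: measurable_cst.
  - move=> E EQ mE; rewrite integral0.
    by have := integral0_measurable KU mE; rewrite (setIidl EQ).
pose bad q : set (plane R) := [set x | K q `<=` U /\ Q q x /\ g x != 0].
have badN q : leb2.-negligible (bad q).
  have [KU|nKU] := pselect (K q `<=` U); last first.
    by rewrite (_ : bad q = set0)//; [exact: negligible_set0|apply/seteqP; split => // x []].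
  have := gQ q KU; apply: negligibleS => x [_ [Qx gx0]] /= H.
  by move: gx0; have [->] := H Qx; rewrite eqxx.
have badU : leb2.-negligible (\bigcup_n (if unpickle n is Some q then bad q else set0)).
  by apply: negligible_bigcup => n; case: unpickle => //; exact: negligible_set0.
apply: negligibleS badU => x /= /not_implyP[Ux /eqP gx0].
have : U x by []. rewrite {1}(open_rat_rectangle oU) => -[q /= Kq Qqx].
by exists (pickle q); [exact: I|rewrite pickleK; split].
Qed.
End fundamental_lemma.

(** * Square integrable functions and test functions *)

Lemma Lfun2P d (T : measurableType d) (R : realType) (mu : {measure set T -> \bar R})
    (f : T -> R) :
  measurable_fun setT f -> mu.-integrable setT (EFin \o (fun x => f x ^+ 2)) ->
  f \in Lfun mu 2%:E.
Proof.
move=> mf /integrableP[_ i2]; rewrite inE; apply/andP; split; rewrite inE//=.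
rewrite /finite_norm unlock /Lnorm; apply: poweR_lty.
rewrite (eq_integral (fun x => `|(f x ^+ 2)%:E|)%E)// => x _ /=.
by rewrite powR_mulrn// normrX.
Qed.

Lemma Lfun_measurable d (T : measurableType d) (R : realType) (mu : {measure set T -> \bar R}) p
    (f : T -> R) : f \in Lfun mu p -> measurable_fun setT f.
Proof. by rewrite inE => /andP[/[!inE]]. Qed.

Lemma Rintegral_sum d (T : measurableType d) (R : realType) (mu : {measure set T -> \bar R})
    (D : set T) (I : Type) (r : seq I) (f : I -> T -> R) :
  measurable D -> (forall i, mu.-integrable D (EFin \o f i)) ->
  mu.-integrable D (EFin \o (fun x => \sum_(i <- r) f i x)) /\
  \int[mu]_(x in D) (\sum_(i <- r) f i x) = \sum_(i <- r) \int[mu]_(x in D) f i x.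
Proof.
move=> mD fi; elim: r => [|i r [ir er]].
  have -> : (fun x => \sum_(i <- [::]) f i x) = cst 0 by apply/funext => x; rewrite big_nil.
  by rewrite big_nil Rintegral_cst// mul0r; split => //; exact: integrable0.
have -> : (fun x => \sum_(j <- i :: r) f j x) = (fun x => f i x + \sum_(j <- r) f j x).
  by apply/funext => x; rewrite big_cons.
rewrite big_cons RintegralD// er; split => //.
exact: (integrableD mD (fi i) ir).
Qed.

Section L2.
Context {R : realType}.
Local Notation leb := (@lebesgue_measure R).
Local Notation leb2 := (leb \x leb)%E.
Implicit Types (U V : set (R * R)) (v w : R * R -> R).

Lemma restrictM U v w : (v \* w) \_ U = v \_ U \* w \_ U.
Proof. by apply/funext => x /=; rewrite !patchE; case: ifP; rewrite ?mulr0. Qed.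

Lemma restrictDZ U (a : R) v w : (a *: v + w) \_ U = a *: (v \_ U) + w \_ U.
Proof.
apply/funext => x; transitivity (a * (v \_ U) x + (w \_ U) x) => //.
by rewrite !patchE; case: ifP => // _; rewrite mulr0 addr0.
Qed.

Lemma restrict_sub U V v : V `<=` U -> v \_ V = (v \_ U) \_ V.
Proof.
move=> VU; apply/funext => x; rewrite !patchE; case: ifPn => // /set_mem Vx.
by rewrite mem_set//; exact: VU.
Qed.

Lemma L2_linear U (a : R) v w : L2 U v -> L2 U w -> L2 U (a *: v + w).
Proof.
move=> Lv Lw; rewrite /L2/= restrictDZ.
by apply: (Lfun_submod_closed leb2 (lee1n 2)).2.
Qed.

Lemma L2_measurable U v : open U -> L2 U v -> measurable_fun U (v : plane R -> R).
Proof.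
move=> oU Lv; have mU := open_measurable_plane oU.
by apply/(measurable_restrictT _ mU); exact: Lfun_measurable Lv.
Qed.

Lemma integrable_mulL2 U v w : open U -> L2 U v -> L2 U w ->
  leb2.-integrable U (EFin \o (v \* w)).
Proof.
move=> oU Lv Lw; apply/(integrable_mkcond _ (open_measurable_plane oU)).
rewrite restrict_EFin restrictM.
exact/Lfun1_integrable/Lfun2_mul_Lfun1.
Qed.

Lemma L2_sub U V v : open V -> V `<=` U -> L2 U v -> L2 V v.
Proof.
move=> oV VU Lv; have mV := open_measurable_plane oV.
have mv : measurable_fun setT (v \_ V : plane R -> R).
  rewrite (restrict_sub _ VU); apply/(measurable_restrictT _ mV).
  by apply: measurable_funTS; exact: Lfun_measurable Lv.
apply: Lfun2P => //.
apply: (@le_integrable _ _ _ leb2 setT measurableT _ (EFin \o (fun x => (v \_ U) x ^+ 2))).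
- by apply/measurable_EFinP; exact: measurable_funX.
- move=> x _; rewrite /= lee_fin !normrX (restrict_sub _ VU) [in leLHS]patchE.
  by case: ifP => // _; rewrite normr0 expr0n/= exprn_ge0.
- exact: Lfun2_integrable_sqr.
Qed.

(** Stated on the whole plane, with [f] vanishing off [U], because membership in [L2 U] is about
    the extension by zero. *)
Lemma Lfun2_bounded (f : R * R -> R) U (C : R) :
  measurable_fun setT (f : plane R -> R) -> open U -> bounded_set U ->
  (forall x, U x -> `|f x| <= C) -> (forall x, ~ U x -> f x = 0) ->
  f \in Lfun leb2 2%:E.
Proof.
move=> mf oU bU fC f0; have mU := open_measurable_plane oU.
apply: Lfun2P => //.
apply: (@le_integrable _ _ _ leb2 setT measurableT _ (EFin \o (cst (C ^+ 2) \_ U))).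
- by apply/measurable_EFinP; exact: measurable_funX.
- move=> x _; rewrite /= lee_fin patchE; case: ifPn => xU.
    rewrite !normrX lerXn2r// ?nnegrE// (le_trans (fC x _))// ?ler_norm//.
    by move: xU; rewrite inE.
  by rewrite f0 ?expr0n/=// => Ux; move: xU; rewrite notin_setE.
- rewrite -restrict_EFin; apply/(integrable_mkcond _ mU).
  apply: measurable_bounded_integrable => //.
  + exact: bounded_measure_lty.
  + exact: bounded_cst.
Qed.

Lemma continuous_bounded_rectangle (f : R * R -> R) a b c d : continuous f ->
  exists C, forall x, closed_rectangle a b c d x -> `|f x| <= C.
Proof.
move=> cf; have cK : compact (closed_rectangle a b c d).
  by apply: compact_setX; exact: segment_compact.
have : compact (f @` closed_rectangle a b c d).
  by apply: continuous_compact => //; apply: continuous_subspaceT.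
move=> /compact_bounded[C [_ HC]]; exists (`|C| + 1) => x Qx.
apply: (HC (`|C| + 1)); last by exists x.
by rewrite (le_lt_trans (ler_norm C))// ltrDl.
Qed.

Lemma continuous_bounded_on U (f : R * R -> R) : continuous f -> bounded_set U ->
  exists C, forall x, U x -> `|f x| <= C.
Proof.
move=> cf /bounded_set_square[M M0 UM].
have [C HC] := continuous_bounded_rectangle (- M) M (- M) M cf.
exists C => x /UM[]; rewrite !ltr_norml => /andP[? ?] /andP[? ?]; apply: HC.
by split; rewrite /= in_itv/= !ltW.
Qed.

Lemma integrable_continuous_support (f : R * R -> R) a b c d : continuous f ->
  (forall x, ~ rectangle a b c d x -> f x = 0) -> leb2.-integrable setT (EFin \o f).
Proof.
move=> cf f0; have mQ := measurable_rectangle a b c d.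
have -> : EFin \o f = (EFin \o f) \_ (rectangle a b c d).
  apply/funext => x; rewrite patchE; case: ifPn => //; rewrite notin_setE => Qx.
  by rewrite /= f0.
apply/(integrable_mkcond _ mQ); apply: measurable_bounded_integrable => //.
- exact: rectangle_lty.
- by apply: measurable_funTS; exact: continuous_measurable_plane.
- have [C HC] := continuous_bounded_rectangle a b c d cf.
  exists C; split; first exact: num_real.
  by move=> z Cz x /rectangle_sub_closed/HC/le_trans; apply; exact: ltW.
Qed.

Lemma L2_continuous U (f : R * R -> R) : open U -> bounded_set U -> continuous f -> L2 U f.
Proof.
move=> oU bU cf; have [C fC] := continuous_bounded_on cf bU.
apply: (Lfun2_bounded (U := U) (C := C)) => //.
- apply/(measurable_restrictT _ (open_measurable_plane oU)).
  by apply: measurable_funTS; exact: continuous_measurable_plane.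
- by move=> x Ux; rewrite patchE mem_set//; exact: fC.
- by move=> x Ux; rewrite patchE memNset.
Qed.

End L2.

Section test_functions.
Context {R : realType}.
Local Notation leb := (@lebesgue_measure R).
Local Notation leb2 := (leb \x leb)%E.
Implicit Types (U V : set (R * R)) (phi : R * R -> R).

Lemma test_function_sub U V phi : V `<=` U -> test_function V phi -> test_function U phi.
Proof. by move=> VU [? ? ?]; split => //; exact: subset_trans VU. Qed.

Lemma test_function_out U phi x : test_function U phi -> ~ U x -> phi x = 0.
Proof.
move=> [_ _ KU] Ux; apply/eqP; apply: contra_notT Ux => px.
by apply: KU; exact: subset_closure.
Qed.

Lemma derive_out phi i x : ~ closure [set x | phi x != 0] x ->
  'D_(unit_vec i) phi x = 0.
Proof.
move=> nK; rewrite (@near_eq_derive _ _ _ _ (cst 0)) ?derive_cst//.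
have : nbhs x (~` closure [set x | phi x != 0]).
  by apply: open_nbhs_nbhs; split => //; apply: closed_openC; exact: closed_closure.
apply: filterS => y nKy; apply/eqP; apply: contra_notT nKy => py.
exact: subset_closure.
Qed.

(** Where the function vanishes on a neighbourhood, so does its derivative: the support does not
    grow. *)
Lemma test_function_derive U phi i : test_function U phi ->
  test_function U (fun x => 'D_(unit_vec i) phi x).
Proof.
move=> [sphi cK KU].
have sub : closure [set x | 'D_(unit_vec i) phi x != 0] `<=` closure [set x | phi x != 0].
  rewrite [X in _ `<=` X](closure_id _).1; last exact: closed_closure.
  apply: closure_subset => x /=; apply: contra_neqP => nK.
  exact: derive_out.
split.
- by move=> s; rewrite -pder_rcons; exact: sphi.
- exact: (subclosed_compact (@closed_closure _ _) cK sub).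
- exact: subset_trans sub KU.
Qed.

Lemma test_function_pder U s phi : test_function U phi -> test_function U (pder s phi).
Proof. by move=> tphi; elim: s => //= i s IH; exact: test_function_derive. Qed.

Lemma test_function_derivable U phi i x : test_function U phi -> derivable phi x (unit_vec i).
Proof. by move=> [/(_ [::])[_]]. Qed.

Lemma test_function_L2 U phi : open U -> bounded_set U -> test_function U phi -> L2 U phi.
Proof. by move=> oU bU tphi; apply: L2_continuous => //; exact: test_function_continuous tphi. Qed.

(** Integrals against a test function do not depend on the domain, which is why weak derivatives
    restrict to subdomains. *)
Lemma Rintegral_test U f phi : test_function U phi ->
  \int[leb2]_(x in U) (f x * phi x) = \int[leb2]_x (f x * phi x).
Proof.
move=> tphi; rewrite Rintegral_mkcond; apply: eq_Rintegral => x _.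
rewrite patchE; case: ifPn => // /negP; rewrite inE => Ux.
by rewrite (test_function_out tphi Ux) mulr0.
Qed.
End test_functions.

(** * Integration by parts *)

Section integration_by_parts.
Context {R : realType}.
Local Notation leb := (@lebesgue_measure R).
Local Notation leb2 := (leb \x leb)%E.
Implicit Types (f g psi : R * R -> R).

Lemma is_derive_continuous (F dF : R -> R) :
  (forall t, is_derive (t : R) (1 : R) F (dF t)) -> continuous F.
Proof.
by move=> dFE t; apply: differentiable_continuous; apply/derivable1_diffP; have [] := dFE t.
Qed.

(** The fundamental theorem of calculus on [[-M, M]]. *)
Lemma integral_derive_support (F dF : R -> R) (M : R) : 0 < M ->
  (forall t, is_derive (t : R) (1 : R) F (dF t)) -> continuous dF ->
  (forall t, M <= `|t| -> F t = 0) -> (forall t, M <= `|t| -> dF t = 0) ->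
  (\int[leb]_t (dF t)%:E = 0)%E.
Proof.
move=> M0 dFE cdF F0 dF0.
have cF := is_derive_continuous dFE.
have -> : (\int[leb]_t (dF t)%:E = \int[leb]_(t in `[(- M)%R, M]) (dF t)%:E)%E.
  rewrite [RHS]integral_mkcond; apply: eq_integral => t _.
  rewrite patchE; case: ifPn => //; rewrite notin_setE/= in_itv/= => /negP tM.
  rewrite dF0//; apply: contraNT tM; rewrite -ltNge => tM.
  by rewrite -ler_norml ltW.
rewrite (continuous_FTC2 (F := F)).
- by rewrite !F0 ?subee// ?normrN ler_norm.
- by rewrite gtrN.
- exact: continuous_subspaceT.
- split; first by move=> t _; have [] := dFE t.
  + exact: cvg_at_right_filter (cF _).
  + exact: cvg_at_left_filter (cF _).
- by move=> t _; rewrite derive1E; have [_ ->] := dFE t.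
Qed.

(** The hypothesis on [l] says that it parametrises a line in direction [i] at unit speed; both
    coordinate directions are instances. *)
Lemma derive_section i (f : R * R -> R) (l : R -> R * R) (t : R) :
  (forall h : R, l (h + t) = h *: unit_vec i + l t) -> derivable f (l t) (unit_vec i) ->
  is_derive (t : R) (1 : R) (f \o l) ('D_(unit_vec i) f (l t)).
Proof.
move=> lE df.
have [d1 d2] : is_derive (l t) (unit_vec i) f ('D_(unit_vec i) f (l t)) by split.
have E : (fun h : R => h^-1 *: (((f \o l) \o shift t) (h *: 1) - (f \o l) t))
       = (fun h : R => h^-1 *: ((f \o shift (l t)) (h *: unit_vec i) - f (l t))).
  by apply/funext => h /=; rewrite [h *: 1]mulr1 lE.
by split; [rewrite /derivable E|rewrite /derive E].
Qed.

(** Fubini, integrating first along the direction of the derivative. *)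
Lemma integral_derive_test psi i :
  (forall x, derivable psi x (unit_vec i)) -> continuous (fun x => 'D_(unit_vec i) psi x) ->
  bounded_set [set x | psi x != 0] ->
  \int[leb2]_x ('D_(unit_vec i) psi x) = 0.
Proof.
move=> dpsi cD bK.
have [M M0 KM] := bounded_set_square bK.
have psi0 x : M <= `|x.1| \/ M <= `|x.2| -> psi x = 0.
  move=> H; apply/eqP; apply: contraPT H => /KM[]/=; rewrite !ltNge => /negP h1 /negP h2.
  by move=> [].
have Kc : closure [set x | psi x != 0] `<=` closed_rectangle (- M) M (- M) M.
  have cl : closed (closed_rectangle (- M) M (- M) M).
    apply: compact_closed; first exact: norm_hausdorff.
    by apply: compact_setX; exact: segment_compact.
  rewrite [X in _ `<=` X](closure_id _).1//; apply: closure_subset => x /KM[].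
  by rewrite !ltr_norml => /andP[/ltW ? /ltW ?] /andP[/ltW ? /ltW ?]; split; rewrite /= in_itv/=; apply/andP.
have D0 x : M < `|x.1| \/ M < `|x.2| -> 'D_(unit_vec i) psi x = 0.
  move=> H; apply: derive_out => /Kc[/=]; rewrite !in_itv/= -!ler_norml !leNgt => /negP h1 /negP h2.
  by case: H.
have mD : measurable_fun setT ((fun x => 'D_(unit_vec i) psi x) : plane R -> R).
  exact: continuous_measurable_plane.
have iD : leb2.-integrable setT (EFin \o (fun x => 'D_(unit_vec i) psi x)).
  apply: (@integrable_continuous_support _ _ (- (M + 1)) (M + 1) (- (M + 1)) (M + 1)) => // x nQ.
  apply: D0; apply/orP; apply: contra_notT nQ; rewrite negb_or -!leNgt => /andP[h1 h2].
  by split; rewrite /= in_itv/= -ltr_norml; [move: h1|move: h2] => /le_lt_trans; apply; rewrite ltrDl.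
rewrite /Rintegral.
have sec (l : R -> R * R) : continuous l -> (forall s t, l (s + t) = s *: unit_vec i + l t) ->
    (forall t, `|t| <= `|(l t).1| \/ `|t| <= `|(l t).2|) ->
    (\int[leb]_t ('D_(unit_vec i) psi (l t))%:E = 0)%E.
  move=> cl lE lge.
  apply: (@integral_derive_support (psi \o l) _ (M + 1)).
  - by rewrite ltr_wpDr.
  - move=> t; apply: derive_section => //.
  - by move=> t; apply: (@continuous_comp _ _ _ l (fun x => 'D_(unit_vec i) psi x)); [exact: cl|exact: cD].
  - move=> t Mt; apply: psi0.
    have Mt' : M <= `|t| by rewrite (le_trans _ Mt)// lerDl.
    by case: (lge t) => H; [left|right]; exact: le_trans H.
  - move=> t Mt; apply: D0.
    have Mt' : M < `|t| by rewrite (lt_le_trans _ Mt)// ltrDl.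
    by case: (lge t) => H; [left|right]; exact: lt_le_trans H.
have zero : (\int[leb2]_x ('D_(unit_vec i) psi x)%:E = 0)%E.
  have [i0|i0] := eqVneq i 0.
    rewrite -(integral21_prod_meas1 iD) /fubini_G; apply: integral0_eq => y _ /=.
    apply: (sec (fun t => (t, y))).
    - by move=> t; apply: (cvg_pair (G := nbhs t) (H := nbhs y)); [exact: cvg_id|exact: cvg_cst].
    - by move=> s t; rewrite i0; congr pair; rewrite /= ?[_ *: 1]mulr1// [_ *: 0]mulr0 add0r.
    - by left.
  have {}i0 : i = 1.
    have H (j : 'I_2) : j != 0 -> j = 1 by case: j => -[|[|//]] j //= _; exact/val_inj.
    exact: H.
  rewrite -(integral12_prod_meas1 iD) /fubini_F; apply: integral0_eq => x _ /=.
  apply: (sec (fun t => (x, t))).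
  - by move=> t; apply: (cvg_pair (G := nbhs x) (H := nbhs t)); [exact: cvg_cst|exact: cvg_id].
  - by move=> s t; rewrite i0; congr pair; rewrite /= ?[_ *: 1]mulr1// [_ *: 0]mulr0 add0r.
  - by right.
by rewrite zero.
Qed.

(** The product rule, and the previous lemma for [f \* phi], which has compact support. *)
Lemma integration_by_parts_test U f phi i : bounded_set U -> Ck 1 f -> test_function U phi ->
  \int[leb2]_x (f x * 'D_(unit_vec i) phi x) = - \int[leb2]_x ('D_(unit_vec i) f x * phi x).
Proof.
move=> bU Cf tphi.
have [cf /(_ i)[df [cdf _]]] := Cf.
have tD := test_function_derive i tphi.
have dphi x : derivable phi x (unit_vec i) by exact: test_function_derivable tphi.
have cphi := test_function_continuous tphi; have cD := test_function_continuous tD.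
have [M M0 UM] := bounded_set_square bU.
have out x : ~ rectangle (- M) M (- M) M x -> ~ U x.
  by apply: contra_not => /UM[h1 h2]; split; rewrite /= in_itv/= -ltr_norml.
have i1 : leb2.-integrable setT (EFin \o (fun x => f x * 'D_(unit_vec i) phi x)).
  apply: (@integrable_continuous_support _ _ (- M) M (- M) M); first exact: continuousM.
  by move=> x /out nU; rewrite (test_function_out tD nU) mulr0.
have i2 : leb2.-integrable setT (EFin \o (fun x => 'D_(unit_vec i) f x * phi x)).
  apply: (@integrable_continuous_support _ _ (- M) M (- M) M).
    by apply: (@continuousM _ (fun x => 'D_(unit_vec i) f x) phi).
  by move=> x /out nU; rewrite (test_function_out tphi nU) mulr0.
apply/eqP; rewrite -addr_eq0 -RintegralD//; apply/eqP.
have DE : (fun x => 'D_(unit_vec i) (f \* phi) x) =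
    (fun x => f x * 'D_(unit_vec i) phi x + 'D_(unit_vec i) f x * phi x).
  by apply/funext => x; rewrite [LHS]deriveM//= [_ *: 'D_(unit_vec i) f x]mulrC.
rewrite -[RHS](@integral_derive_test (f \* phi) i).
- by apply: eq_Rintegral => x _; rewrite -[RHS]/((fun x => 'D_(unit_vec i) (f \* phi) x) x) DE.
- by move=> x; exact: derivableM.
- rewrite DE; apply: continuousD; first exact: continuousM.
  by apply: (@continuousM _ (fun x => 'D_(unit_vec i) f x) phi).
- case: bU => B [Br HB]; exists B; split => // z Bz x /= fp; apply: HB => //.
  apply: contrapT => nU; move: fp; by rewrite (test_function_out tphi nU) mulr0 eqxx.
Qed.

(** Integrate by parts one direction at a time; [pder] peels the outermost derivative of the
    test function. The weak derivative is again smooth, hence square integrable on bounded sets. *)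
Lemma smooth_weak_derivative U s f : bounded_set U -> (forall n, Ck n f) ->
  exists2 g, (forall n, Ck n g) & weak_derivative U s f g.
Proof.
move=> bU; elim: s f => [|i s IH] f Cf.
  by exists f => // phi tphi; rewrite expr0 mul1r.
have [g Cg wg] := IH _ (fun n => ((Cf n.+1).2 i).2).
exists g => // phi tphi; have ts := test_function_pder s tphi.
rewrite /= (Rintegral_test _ (test_function_derive i ts)).
rewrite (integration_by_parts_test i bU (Cf 1%N) ts) -(Rintegral_test _ ts) wg//.
by rewrite exprS -mulrA mulN1r.
Qed.
End integration_by_parts.

(** * Lipschitz domains *)

Section domain.
Context {R : realType}.
Implicit Types (x y : R * R) (Omega : set (R * R)).

Lemma dist2_le x y : dist2 x y <= `|x.1 - y.1| + `|x.2 - y.2|.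
Proof.
rewrite /dist2 -[leRHS]ger0_norm ?addr_ge0// -sqrtr_sqr; apply: ler_wsqrtr.
rewrite [leRHS]sqrrD !real_normK ?num_real//.
by rewrite -addrA lerD2l [leRHS]addrC lerDl mulrn_wge0// mulr_ge0.
Qed.



Lemma continuous_dist2 x : continuous (dist2 x).
Proof.
move=> y; apply: (@continuous_comp _ _ _ 
  (fun y : R * R => (x.1 - y.1) ^+ 2 + (x.2 - y.2) ^+ 2) Num.sqrt); last exact: sqrt_continuous.
apply: cvgD.
  apply: (@continuous_comp _ _ _ (fun y : R * R => x.1 - y.1) (fun t => t ^+ 2));
    last exact: exprn_continuous.
  by apply: cvgB; [exact: cvg_cst|exact: cvg_fst].
apply: (@continuous_comp _ _ _ (fun y : R * R => x.2 - y.2) (fun t => t ^+ 2));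
  last exact: exprn_continuous.
by apply: cvgB; [exact: cvg_cst|exact: cvg_snd].
Qed.

(** Near a boundary point the domain is the epigraph of a Lipschitz function,
    so that points just below the graph are not in the closure. *)
Lemma interior_closure_lipschitz Omega : lipschitz_boundary Omega ->
  (closure Omega)° `<=` Omega.
Proof.
move=> lip x xi; apply: contrapT => nx.
have [c [s [r [gamma [cs r0 lipg H]]]]] := lip x (conj (interior_subset xi) nx).
have xx : dist2 x x < r by rewrite (le_lt_trans (dist2_le _ _))// !subrr normr0 addr0.
have g0 : 0 <= gamma 0.
  rewrite leNgt; apply/negP => g0; apply: nx; apply/(H x xx).
  by rewrite !subrr !mulr0 subrr addr0.
have [L L0 lipL] : exists2 L : R, 0 < L & forall u v, `|gamma u - gamma v| <= L * `|u - v|.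
  case: lipg => L [_ HL]; exists (`|L| + 1); first by rewrite ltr_wpDl.
  by move=> u v; apply: (HL (`|L| + 1) _ (u, v)) => //; rewrite (le_lt_trans (ler_norm L))// ltrDl.
have [e /= e0 xe] : exists2 e : R, 0 < e & ball x e `<=` closure Omega.
  by move: xi => /nbhs_ballP[e e0 He]; exists e.
pose t := Num.min e r / 4.
have m0 : 0 < Num.min e r by rewrite lt_min e0.
have t0 : 0 < t by rewrite divr_gt0.
have te : t < e by rewrite /t ltr_pdivrMr// (le_lt_trans (y := e)) ?ge_min ?lexx// ltr_pMr// ltr1n.
have tr : t + t < r.
  rewrite -mulr2n -mulr_natr /t -mulrA (le_lt_trans (y := r * (4^-1 * 2)))//.
    by rewrite ler_wpM2r// ge_min lexx orbT.
  by rewrite gtr_pMr//; lra.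
have c1 : `|c| <= 1.
  by rewrite -(@expr_le1 _ 2)// real_normK ?num_real// -cs lerDl sqr_ge0.
have s1 : `|s| <= 1.
  by rewrite -(@expr_le1 _ 2)// real_normK ?num_real// -cs lerDr sqr_ge0.
(* the point at distance [t] below the origin of the local frame *)
pose y0 : R * R := (x.1 + t * s, x.2 - t * c).
have n1 : `|x.1 - y0.1| <= t.
  by rewrite opprD addrA subrr add0r normrN normrM gtr0_norm// ger_pMr.
have n2 : `|x.2 - y0.2| <= t.
  by rewrite opprB addrCA subrr addr0 normrM gtr0_norm// ger_pMr.
have dy0 : dist2 x y0 < r by rewrite (le_lt_trans (dist2_le _ _))// (le_lt_trans _ tr)// lerD.
have : closure Omega y0 by apply: xe; split; [exact: le_lt_trans te|exact: le_lt_trans te].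
pose u y := c * (y.1 - x.1) + s * (y.2 - x.2).
pose w y := c * (y.2 - x.2) - s * (y.1 - x.1).
have cu : continuous u.
  rewrite (_ : u = fun y => c * y.1 + s * y.2 + (- c * x.1 - s * x.2)); first exact: continuous_affine2.
  by apply/funext => y; rewrite /u; ring.
have cw : continuous w.
  rewrite (_ : w = fun y => - s * y.1 + c * y.2 + (s * x.1 - c * x.2)); first exact: continuous_affine2.
  by apply/funext => y; rewrite /w; ring.
have u0 : u y0 = 0 by rewrite /u/=; ring.
have w0 : w y0 = - t.
  rewrite -[RHS]mulr1 -cs /w/=; ring.
have t2 : 0 < t / 2 by rewrite divr_gt0.
have tL : 0 < t / 2 / L by rewrite divr_gt0.
move=> /(_ [set y | [/\ dist2 x y < r, `|u y0 - u y| < t / 2 / L &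
  `|w y0 - w y| < t / 2]])[|y [Oy [dy uy wy]]].
  near=> y; split; near: y.
  - by apply: (cvgr_lt (dist2 x y0)) => //; exact: continuous_dist2.
  - by move/cvgrPdist_lt : (cu y0); apply.
  - by move/cvgrPdist_lt : (cw y0); apply.
move/(H y dy) : Oy; apply/negP; rewrite -leNgt.
have h1 : gamma (u y) >= - (t / 2).
  have := lipL (u y0) (u y); rewrite u0 => hl.
  have : L * `|0 - u y| <= t / 2.
    by rewrite -ler_pdivlMl// mulrC ltW//; rewrite u0 in uy.
  move=> /(le_trans hl); rewrite ler_norml => /andP[_]; lra.
apply: le_trans h1; move: wy; rewrite w0 ltr_norml => /andP[h2 _].
rewrite -/(w y); lra.
Unshelve. all: by end_near.
Qed.
End domain.

(** The inverse is continuous off the origin, which is measurable. *)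
Lemma measurable_inv (R : realType) : measurable_fun [set: R] (@GRing.inv R).
Proof.
rewrite -(setUv [set (0 : R)]); apply/measurable_funU => //; first exact: measurableC.
split; first exact: measurable_fun_set1.
apply: open_continuous_measurable_fun.
  rewrite (_ : ~` [set 0] = [set x : R | x != 0]); first exact: open_neq.
  by apply/seteqP; split => x /= /eqP.
by move=> x /set_mem/= /eqP x0; exact: inv_continuous.
Qed.

(** * Triangles and triangulations *)

Section triangle.
Context {R : realType}.
Local Notation leb := (@lebesgue_measure R).
Local Notation leb2 := (leb \x leb)%E.
Implicit Types (p q x z : R * R) (t : 'I_3 -> R * R).

Local Notation i0 := (@inord 2 0).
Local Notation i1 := (@inord 2 1).
Local Notation i2 := (@inord 2 2).

Lemma ord3P (P : 'I_3 -> Prop) : P i0 -> P i1 -> P i2 -> forall i, P i.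
Proof.
move=> P0 P1 P2 i.
have : i = i0 \/ i = i1 \/ i = i2.
  by case: i => -[|[|[|//]]] i; [left|right;left|right;right]; apply/val_inj; rewrite /= inordK.
by move=> [->|[->|->]].
Qed.

Lemma sum_ord3 (V : nmodType) (F : 'I_3 -> V) : \sum_i F i = F i0 + F i1 + F i2.
Proof.
rewrite !big_ord_recl big_ord0 addr0 addrA.
by congr (F _ + F _ + F _); apply/val_inj; rewrite /= inordK.
Qed.

(** Twice the signed area of the triangle [p q z]. *)
Definition area p q z : R := (q.1 - p.1) * (z.2 - p.2) - (q.2 - p.2) * (z.1 - p.1).

(** The barycentric coordinates, up to the factor [triangle_area t]. *)
Definition bary t (i : 'I_3) z : R :=
  if i == i0 then area (t i1) (t i2) z
  else if i == i1 then area (t i2) (t i0) z else area (t i0) (t i1) z.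

Let i10 : (i1 == i0) = false. Proof. by rewrite -val_eqE /= !inordK. Qed.
Let i20 : (i2 == i0) = false. Proof. by rewrite -val_eqE /= !inordK. Qed.
Let i21 : (i2 == i1) = false. Proof. by rewrite -val_eqE /= !inordK. Qed.

Lemma bary0 t z : bary t i0 z = area (t i1) (t i2) z.
Proof. by rewrite /bary eqxx. Qed.
Lemma bary1 t z : bary t i1 z = area (t i2) (t i0) z.
Proof. by rewrite /bary i10 eqxx. Qed.
Lemma bary2 t z : bary t i2 z = area (t i0) (t i1) z.
Proof. by rewrite /bary i20 i21. Qed.

Definition triangle_area t : R := area (t i0) (t i1) (t i2).

Lemma nondegenerateE t : Defs.nondegenerate t <-> triangle_area t != 0. Proof. by []. Qed.

Lemma bary_comb t (l : 'I_3 -> R) i : \sum_k l k = 1 ->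
  bary t i (\sum_k l k *: t k) = l i * triangle_area t.
Proof.
rewrite !sum_ord3 => l1; have -> : l i0 = 1 - l i1 - l i2 by rewrite -l1; ring.
elim/ord3P: i; rewrite ?bary0 ?bary1 ?bary2 /triangle_area /area /= /GRing.scale /=.
- have -> : l i0 = 1 - l i1 - l i2 by rewrite -l1; ring.
  by ring.
- by ring.
- by ring.
Qed.

Lemma comb_bary t z : Defs.nondegenerate t ->
  \sum_i bary t i z / triangle_area t = 1 /\ z = \sum_i (bary t i z / triangle_area t) *: t i.
Proof.
move=> /nondegenerateE D0; rewrite !sum_ord3 !bary0 !bary1 !bary2; split.
  by move: D0; rewrite /triangle_area /area => D0; field.
case: z => z1 z2; move: D0; rewrite /triangle_area /area /= => D0.
by congr pair; rewrite /= /GRing.scale/=; field.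
Qed.

Lemma bary_affine t i : exists a b c : R, (fun z => bary t i z) = (fun z => a * z.1 + b * z.2 + c).
Proof.
have H p q : exists a b c : R, (fun z => area p q z) = (fun z => a * z.1 + b * z.2 + c).
  exists (- (q.2 - p.2)), (q.1 - p.1), ((q.2 - p.2) * p.1 - (q.1 - p.1) * p.2).
  by apply/funext => z; rewrite /area; ring.
elim/ord3P: i.
- have [a [b [c E]]] := H (t i1) (t i2); exists a, b, c; rewrite -E.
  by apply/funext => z; rewrite bary0.
- have [a [b [c E]]] := H (t i2) (t i0); exists a, b, c; rewrite -E.
  by apply/funext => z; rewrite bary1.
- have [a [b [c E]]] := H (t i0) (t i1); exists a, b, c; rewrite -E.
  by apply/funext => z; rewrite bary2.
Qed.

Lemma continuous_bary t i : continuous (bary t i).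
Proof.
have [a [b [c E]]] := bary_affine t i.
by have := @continuous_affine2 R a b c; rewrite -E.
Qed.

(** A line: the affine function [bary t i] takes the distinct values [0] and [triangle_area t] at
    the vertices, so it is not constant. *)
Lemma bary_negligible t i : Defs.nondegenerate t ->
  leb2.-negligible [set z | bary t i z = 0].
Proof.
move=> nt; have [a [b [c E]]] := bary_affine t i.
have Ez z : bary t i z = a * z.1 + b * z.2 + c by rewrite -[LHS]/((fun z => bary t i z) z) E.
rewrite (_ : mkset _ = [set z | a * z.1 + b * z.2 + c = 0]); last first.
  by apply/seteqP; split => z /=; rewrite Ez.
apply: line_negligible; rewrite -negb_and; apply/negP => /andP[/eqP a0 /eqP b0].
have vert k : bary t i (t k) = (k == i)%:R * triangle_area t.
  have s1 : \sum_k' (k' == k)%:R = 1 :> R.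
    by rewrite (bigD1 k)//= eqxx big1 ?addr0// => j /negbTE ->.
  rewrite eq_sym -[RHS](bary_comb _ _ s1); congr bary.
  by rewrite (bigD1 k)//= eqxx scale1r big1 ?addr0// => j /negbTE ->; rewrite scale0r.
have c0 k : bary t i (t k) = c by rewrite Ez a0 b0 !mul0r !add0r.
have /nondegenerateE/eqP := nt; apply.
have := vert i; rewrite eqxx mul1r => <-.
have [k ki] : exists k, k != i by elim/ord3P: i {E Ez vert c0}; 
    [exists i1; rewrite i10|exists i0; rewrite eq_sym i10|exists i0; rewrite eq_sym i20].
by rewrite c0 -(c0 k) vert (negbTE ki) mul0r.
Qed.

Lemma triangle_comb t z : triangle t z <->
  exists l : 'I_3 -> R, [/\ forall i, 0 <= l i, \sum_i l i = 1 & z = \sum_i l i *: t i].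
Proof.
rewrite /triangle /hull.
have E (V : nmodType) (F : 'I_3 -> V) : \sum_(i in finset.setTfor 'I_3) F i = \sum_i F i.
  by apply: eq_bigl => i; rewrite inE.
by split => -[l [l0 l1 zE]]; exists l; rewrite ?E in l1 zE *.
Qed.

Lemma triangle_interior t z : Defs.nondegenerate t ->
  (forall i, 0 < bary t i z / triangle_area t) -> (triangle t)° z.
Proof.
move=> nt z0.
have near_i i : \forall y \near z, 0 < bary t i y / triangle_area t.
  have H : (fun y => bary t i y / triangle_area t) @ z --> bary t i z / triangle_area t.
    by apply: cvgM; [exact: continuous_bary|exact: cvg_cst].
  by move: H => /cvgr_gt; apply; exact: z0.
have : \forall y \near z, triangle t y.
  near=> y; apply/triangle_comb; exists (fun i => bary t i y / triangle_area t).
  have [e1 e2] := comb_bary y nt; split => //.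
  by elim/ord3P; apply: ltW; near: y; exact: near_i.
by [].
Unshelve. all: by end_near.
Qed.

(** Off the interior, some barycentric coordinate vanishes. *)
Lemma triangle_boundary_negligible t : Defs.nondegenerate t ->
  leb2.-negligible (triangle t `\` (triangle t)°).
Proof.
move=> nt; have D0 : triangle_area t != 0 by exact/nondegenerateE.
apply: (@negligibleS _ _ _ leb2 ([set z | bary t i0 z = 0] `|`
    ([set z | bary t i1 z = 0] `|` [set z | bary t i2 z = 0]))); last first.
  by do 2?[apply: negligibleU]; exact: bary_negligible.
move=> z [/triangle_comb[l [l0 l1 zE]] nz].
have bl i : bary t i z = l i * triangle_area t by rewrite zE bary_comb.
apply: contrapT => /not_orP[/= n0 /not_orP[/= n1 n2]]; apply: nz.
apply: triangle_interior => // i; rewrite bl mulfK// lt_neqAle l0 andbT eq_sym.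
by apply/eqP => li0; move: i li0; apply: ord3P => li0;
  [apply: n0|apply: n1|apply: n2]; rewrite bl li0 mul0r.
Qed.

(** A face misses a vertex, hence lies on a line. *)
Lemma hull_negligible t (F : {set 'I_3}) : Defs.nondegenerate t -> (#|F| <= 2)%N ->
  leb2.-negligible (hull t F).
Proof.
move=> nt F2.
have [k kF] : exists k, k \notin F.
  apply: contrapT => nk; suff : (#|F| == 3)%N by move/eqP=> F3; rewrite F3 in F2.
  rewrite (_ : F = finset.setTfor 'I_3) ?cardsT ?card_ord//.
  by apply/setP => k; rewrite inE; apply: contrapT => /negP kF; apply: nk; exists k.
apply: negligibleS (bary_negligible k nt) => z [l [_ l1 zE]] /=.
pose l' i := if i \in F then l i else 0.
have -> : z = \sum_i l' i *: t i.
  by rewrite zE big_mkcond; apply: eq_bigr => i _; rewrite /l'; case: ifP; rewrite ?scale0r.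
rewrite bary_comb; first by rewrite /l' (negbTE kF) mul0r.
by rewrite -[RHS]l1 [RHS]big_mkcond; apply: eq_bigr.
Qed.

Lemma vertex_triangle t k : triangle t (t k).
Proof.
apply/triangle_comb; exists (fun i => (i == k)%:R); split => //.
  by rewrite (bigD1 k)//= eqxx big1 ?addr0// => j /negbTE ->.
by rewrite (bigD1 k)//= eqxx scale1r big1 ?addr0// => j /negbTE ->; rewrite scale0r.
Qed.

Lemma triangle_bound t : exists B : R, forall x y, triangle t x -> triangle t y -> dist2 x y <= B.
Proof.
pose C1 := \sum_i `|(t i).1|; pose C2 := \sum_i `|(t i).2|.
have H z : triangle t z -> `|z.1| <= C1 /\ `|z.2| <= C2.
  move=> /triangle_comb[l [l0 l1 ->]].
  have lle i : l i <= 1 by rewrite -l1 (bigD1 i)//= lerDl sumr_ge0.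
  rewrite /C1 /C2 !sum_ord3 /= /GRing.scale/=.
  have K i (c : R) : `|l i * c| <= `|c| by rewrite normrM ger0_norm// ler_piMl.
  by split; (apply: le_trans (ler_normD _ _) _; apply: lerD => //;
     apply: le_trans (ler_normD _ _) _; apply: lerD).
exists ((C1 + C1) + (C2 + C2)) => x y /H[x1 x2] /H[y1 y2].
apply: le_trans (dist2_le _ _) _; apply: lerD.
  by apply: le_trans (ler_normB _ _) _; exact: lerD.
by apply: le_trans (ler_normB _ _) _; exact: lerD.
Qed.

Lemma diam_triangle_gt0 t : Defs.nondegenerate t -> 0 < diam (triangle t).
Proof.
move=> nt; have [B HB] := triangle_bound t.
have : dist2 (t i0) (t i1) <= diam (triangle t).
  apply: ub_le_sup; first by exists B => r [x [y [Tx Ty ->]]]; exact: HB.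
  by exists (t i0), (t i1); split => //; exact: vertex_triangle.
apply: lt_le_trans; rewrite /dist2 sqrtr_gt0 lt_neqAle addr_ge0 ?sqr_ge0// andbT eq_sym.
rewrite paddr_eq0 ?sqr_ge0// !sqrf_eq0; apply/negP => /andP[h1 h2].
have /nondegenerateE/eqP := nt; apply; rewrite /triangle_area /area.
by move: h1 h2; rewrite !subr_eq0 => /eqP -> /eqP ->; ring.
Qed.
End triangle.

Section triangulation.
Context {R : realType}.
Local Notation leb := (@lebesgue_measure R).
Local Notation leb2 := (leb \x leb)%E.
Variables (Omega : set (R * R)) (N : nat) (T : 'I_N -> 'I_3 -> R * R).
Hypothesis lipO : lipschitz_boundary Omega.
Hypothesis hT : triangulation Omega T.

Let K j := (triangle (T j))°.

Lemma measurable_triangle_interior j : measurable (K j : set (plane R)).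
Proof. by apply: open_measurable_plane; exact: open_interior. Qed.

Lemma triangle_interior_sub j : K j `<=` Omega.
Proof.
move: hT => [_ clO _]; apply: subset_trans (interior_closure_lipschitz lipO).
by apply: interiorS; rewrite clO => x Tx; exists j.
Qed.

Lemma negligible_bigcup_ord (n : nat) (A : 'I_n -> set (plane R)) :
  (forall j, leb2.-negligible (A j)) -> leb2.-negligible (\bigcup_j A j).
Proof.
move=> nA; pose B (k : nat) : set (plane R) := if insub k is Some j then A j else set0.
apply: (@negligibleS _ _ _ leb2 (\bigcup_k B k)).
  by move=> x [j _ Ajx]; exists (j : nat) => //; rewrite /B valK.
apply: negligible_bigcup => k; rewrite /B; case: insub => //.
exact: negligible_set0.
Qed.

(** The exceptional points lie on the boundary of a triangle or on a face shared by two triangles,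
    hence on finitely many lines. *)
Lemma triangulation_ae : {ae leb2, forall x, Omega x -> \sum_j \1_(K j) x = 1 :> R}.
Proof.
have [nd clO adj] := hT.
pose Z := (\bigcup_j (triangle (T j) `\` K j)) `|`
  \bigcup_j \bigcup_k (if j == k then set0 else K j `&` K k).
have nZ : leb2.-negligible Z.
  apply: negligibleU.
    by apply: negligible_bigcup_ord => j; exact: triangle_boundary_negligible.
  apply: negligible_bigcup_ord => j; apply: negligible_bigcup_ord => k.
  have [jk|jk] := eqVneq j k; first exact: negligible_set0.
  have [F [G [F2 _ TF _]]] := adj _ _ jk.
  apply: negligibleS (hull_negligible (nd j) F2); rewrite -TF.
  by move=> x [/interior_subset ? /interior_subset ?].
apply: negligibleS nZ => x /= /not_implyP[Ox nx].
apply: contrapT => nZx; apply: nx.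
have /subset_closure : Omega x by [].
rewrite clO => -[j _ Tjx].
have Kjx : K j x by apply: contrapT => nK; apply: nZx; left; exists j.
rewrite (bigD1 j)//= indicE mem_set// big1 ?addr0// => k kj.
rewrite indicE memNset// => Kkx; apply: nZx; right.
by exists j => //; exists k => //; rewrite eq_sym (negbTE kj).
Qed.

(** The indicators of the interiors add up to [1] almost everywhere, by [triangulation_ae]. *)
Lemma Rintegral_triangulation (f : R * R -> R) : open Omega ->
  leb2.-integrable Omega (EFin \o f) ->
  \int[leb2]_(x in Omega) f x = \sum_j \int[leb2]_(x in K j) f x.
Proof.
move=> oO ifO.
have mO := open_measurable_plane oO.
have mK := measurable_triangle_interior.
have iK j : leb2.-integrable (K j) (EFin \o f).
  by apply: (integrableS mO) => //; exact: triangle_interior_sub.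
have iK' j : leb2.-integrable setT (EFin \o (f \_ (K j))).
  by rewrite -restrict_EFin; apply/(integrable_mkcond _ (mK j)); exact: iK.
have iO' : leb2.-integrable setT (EFin \o (f \_ Omega)).
  by rewrite -restrict_EFin; apply/(integrable_mkcond _ mO).
have [iS eS] := Rintegral_sum (index_enum 'I_N) measurableT iK'.
rewrite Rintegral_mkcond; under [RHS]eq_bigr do rewrite Rintegral_mkcond.
rewrite -eS; congr fine; apply: ae_eq_integral => //.
- exact: measurable_int iO'.
- exact: measurable_int iS.
- apply: negligibleS triangulation_ae => x /=; apply: contra_not => H _.
  rewrite patchE; case: ifPn => [/set_mem Ox|/negP nOx]; congr EFin.
    rewrite -[LHS]mulr1 -(H Ox) mulr_sumr; apply: eq_bigr => j _.
    by rewrite patchE indicE; case: ifP; rewrite ?mulr1 ?mulr0.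
  rewrite big1// => j _; rewrite patchE; case: ifPn => // /set_mem /triangle_interior_sub Ox.
  by exfalso; apply: nOx; rewrite inE.
Qed.

Lemma mesh_size_gt0 j x : K j x -> 0 < mesh_size T x.
Proof.
have [nd _ _] := hT.
move=> Kx; rewrite /mesh_size (bigD1 j)//= ltr_pwDl//.
  by rewrite indicE mem_set// mulr1 diam_triangle_gt0.
apply: sumr_ge0 => k _; rewrite indicE mulr_ge0//.
exact/ltW/diam_triangle_gt0.
Qed.

Lemma measurable_mesh_size : measurable_fun setT (mesh_size T : plane R -> R).
Proof.
rewrite /mesh_size; apply: measurable_sum => j; apply: measurable_funM => //.
by apply: measurable_indic; exact: measurable_triangle_interior.
Qed.

(** The weight is positive on the interiors of the triangles, hence almost everywhere. *)
Lemma mesh_L2norm_eq0 m (f : R * R -> R) : open Omega -> L2 Omega f ->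
  (L2norm Omega (fun x => (mesh_size T x) ^- m * f x)%R <= 0)%E ->
  eqL2 Omega f (cst 0).
Proof.
move=> oO Lf n0; have mO := open_measurable_plane oO.
have {}n0 : L2norm Omega (fun x => (mesh_size T x) ^- m * f x)%R = 0%E.
  by apply/eqP; rewrite eq_le n0 Lnorm_ge0.
have mf : measurable_fun setT (EFin \o ((fun x => (mesh_size T x) ^- m * f x) \_ Omega)
    : plane R -> \bar R).
  apply/measurable_EFinP; apply/(measurable_restrictT _ mO).
  apply: measurable_funM; last exact: L2_measurable.
  apply: measurable_funTS; apply: (measurableT_comp (@measurable_inv R)).
  exact: measurable_funX measurable_mesh_size.
have p2 : (0 < (2 : R)%:E)%E by rewrite lte_fin.
have H := Lnorm_eq0_eq0 mf p2 n0; have := triangulation_ae; apply: filterS2 H => x /= H H1 Ox.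
have [j Kj] : exists j, K j x.
  apply: contrapT => nK; have := H1 Ox; rewrite big1 => [/eqP|j _].
    by rewrite eq_sym oner_eq0.
  by rewrite indicE memNset// => Kx; apply: nK; exists j.
have := H I; rewrite patchE mem_set// => -[] /eqP; rewrite mulf_eq0 => /orP[|/eqP//].
by rewrite invr_eq0 expf_eq0 gt_eqF ?andbF// (mesh_size_gt0 Kj).
Qed.
End triangulation.

(** * Weak derivatives and the energy *)

Section weak_derivative.
Context {R : realType}.
Local Notation leb := (@lebesgue_measure R).
Local Notation leb2 := (leb \x leb)%E.
Implicit Types (U V : set (R * R)) (v w g h z : R * R -> R).

Lemma integrable_L2 U v : open U -> bounded_set U -> L2 U v -> leb2.-integrable U (EFin \o v).
Proof.
move=> oU bU Lv.
have L1 : L2 U (cst 1) by apply: L2_continuous => //; exact: cst_continuous.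
have := integrable_mulL2 oU Lv L1.
by rewrite (_ : v \* cst 1 = v)//; apply/funext => x /=; rewrite mulr1.
Qed.

Lemma eqL2_sub U V v w : V `<=` U -> eqL2 U v w -> eqL2 V v w.
Proof. by move=> VU; apply: filterS => x H /VU. Qed.

(** The difference is orthogonal to all test functions, so [fundamental_lemma] applies. *)
Lemma weak_derivative_unique U (s : seq 'I_2) v g h : open U -> bounded_set U -> L2 U g -> L2 U h ->
  weak_derivative U s v g -> weak_derivative U s v h -> eqL2 U g h.
Proof.
move=> oU bU Lg Lh wg wh.
have Lgh : L2 U (g - h) by rewrite addrC -scaleN1r; exact: L2_linear.
have := @fundamental_lemma R U (g - h) oU (integrable_L2 oU bU Lgh).
have mU := open_measurable_plane oU.
move=> F; have {}F : eqL2 U (g - h) (cst 0).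
  apply: F => phi tphi; have Lphi := test_function_L2 oU bU tphi.
  under eq_Rintegral do rewrite mulrBl.
  rewrite RintegralB//; [|exact: integrable_mulL2..].
  apply/eqP; rewrite subr_eq0; apply/eqP.
  have := wg _ tphi; rewrite (wh _ tphi) => /esym; apply: mulrI.
  by rewrite unitrX// unitrN1.
by apply: filterS F => x H Ux; apply/eqP; rewrite -subr_eq0; apply/eqP; exact: H.
Qed.

Lemma weak_derivative_linear U (s : seq 'I_2) (a : R) v w g h : open U -> bounded_set U ->
  L2 U v -> L2 U w -> L2 U g -> L2 U h ->
  weak_derivative U s v g -> weak_derivative U s w h ->
  weak_derivative U s (a *: v + w) (a *: g + h).
Proof.
move=> oU bU Lv Lw Lg Lh wg wh phi tphi.
have mU := open_measurable_plane oU.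
have Lphi := test_function_L2 oU bU tphi.
have Lpder := test_function_L2 oU bU (test_function_pder s tphi).
have H f1 f2 psi : L2 U f1 -> L2 U f2 -> L2 U psi ->
    \int[leb2]_(x in U) ((a *: f1 + f2) x * psi x) =
    a * \int[leb2]_(x in U) (f1 x * psi x) + \int[leb2]_(x in U) (f2 x * psi x).
  move=> L1 L2' L3.
  have i1 := integrable_mulL2 oU L1 L3.
  rewrite -RintegralZl// -RintegralD//; last exact: integrable_mulL2.
    by apply: eq_Rintegral => x _; rewrite mulrDl -mulrA.
  exact: (integrableZl mU a i1).
by rewrite !H// wg// wh// mulrDr mulrCA.
Qed.

Lemma weak_derivative_sub U V (s : seq 'I_2) v g : V `<=` U ->
  weak_derivative U s v g -> weak_derivative V s v g.
Proof.
move=> VU wg phi tphi; have tU := test_function_sub VU tphi.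
have := wg _ tU; rewrite !(Rintegral_test _ tU) !(Rintegral_test _ tphi).
by rewrite (Rintegral_test _ (test_function_pder s tU)) (Rintegral_test _ (test_function_pder s tphi)).
Qed.

Lemma weak_derivative_ae U (s : seq 'I_2) v w g : open U -> bounded_set U ->
  L2 U v -> L2 U w -> eqL2 U v w ->
  weak_derivative U s v g -> weak_derivative U s w g.
Proof.
move=> oU bU Lv Lw vw wg phi tphi; rewrite -(wg _ tphi).
have mU := open_measurable_plane oU.
have Lpder := test_function_L2 oU bU (test_function_pder s tphi).
congr fine; apply: ae_eq_integral => //.
- exact: (measurable_int _ (integrable_mulL2 oU Lw Lpder)).
- exact: (measurable_int _ (integrable_mulL2 oU Lv Lpder)).
- by apply: filterS vw => x H Ux; rewrite H.
Qed.

(** Intermediate orders are left out, because only the derivatives of order [m] enter the energy. *)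
Definition has_weak_derivatives (m : nat) U v : Prop :=
  L2 U v /\ forall s : m.-tuple 'I_2, exists2 g, L2 U g & weak_derivative U s v g.

Lemma wderP U (s : seq 'I_2) v : (exists2 g, L2 U g & weak_derivative U s v g) ->
  L2 U (wder U s v) /\ weak_derivative U s v (wder U s v).
Proof.
move=> [g Lg wg]; rewrite /wder.
by case: xgetP => [_ -> []//|/(_ g)[]].
Qed.

(** The two functions have the same set of weak derivatives, from which [wder] makes its choice;
    so this is an equality and not merely an equality almost everywhere. *)
Lemma wder_ae U (s : seq 'I_2) v w : open U -> bounded_set U -> L2 U v -> L2 U w -> eqL2 U v w ->
  wder U s v = wder U s w.
Proof.
move=> oU bU Lv Lw vw; rewrite /wder; congr xget; apply/seteqP.
have wv : eqL2 U w v by exact: ae_eq_sym.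
by split => g [Lg wg]; split => //; [exact: weak_derivative_ae vw wg|exact: weak_derivative_ae wv wg].
Qed.

(** By uniqueness, the choice made by [wder] does not matter. *)
Lemma energy_formE m U v w (G H : m.-tuple 'I_2 -> R * R -> R) : open U -> bounded_set U ->
  (forall s, L2 U (G s)) -> (forall s, L2 U (H s)) ->
  (forall s : m.-tuple 'I_2, weak_derivative U s v (G s)) ->
  (forall s : m.-tuple 'I_2, weak_derivative U s w (H s)) ->
  energy_form m U v w = \sum_(s : m.-tuple 'I_2) \int[leb2]_(x in U) (G s x * H s x).
Proof.
move=> oU bU LG LH wG wH; have mU := open_measurable_plane oU.
have V (s : m.-tuple 'I_2) := wderP (ex_intro2 _ _ _ (LG s) (wG s)).
have W (s : m.-tuple 'I_2) := wderP (ex_intro2 _ _ _ (LH s) (wH s)).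
have I (s : m.-tuple 'I_2) := integrable_mulL2 oU (V s).1 (W s).1.
rewrite /energy_form (Rintegral_sum _ mU I).2; apply: eq_bigr => s _.
congr fine; apply: ae_eq_integral => //.
- exact: measurable_int (I s).
- exact: (measurable_int _ (integrable_mulL2 oU (LG s) (LH s))).
- have vG := weak_derivative_unique oU bU (V s).1 (LG s) (V s).2 (wG s).
  have wH' := weak_derivative_unique oU bU (W s).1 (LH s) (W s).2 (wH s).
  by apply: filterS2 vG wH' => x h1 h2 Ux; rewrite /= h1// h2.
Qed.

Lemma energy_form_wder m U v w : open U -> bounded_set U ->
  has_weak_derivatives m U v -> has_weak_derivatives m U w ->
  energy_form m U v w =
  \sum_(s : m.-tuple 'I_2) \int[leb2]_(x in U) (wder U s v x * wder U s w x).
Proof.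
move=> oU bU [_ Hv] [_ Hw].
exact: (energy_formE oU bU (fun s => (wderP (Hv s)).1) (fun s => (wderP (Hw s)).1)
  (fun s => (wderP (Hv s)).2) (fun s => (wderP (Hw s)).2)).
Qed.

Lemma has_weak_derivatives_linear m U (a : R) v w : open U -> bounded_set U ->
  has_weak_derivatives m U v -> has_weak_derivatives m U w ->
  has_weak_derivatives m U (a *: v + w).
Proof.
move=> oU bU [Lv Hv] [Lw Hw]; split; first exact: L2_linear.
move=> s; have [g Lg wg] := Hv s; have [h Lh wh] := Hw s.
by exists (a *: g + h); [exact: L2_linear|exact: weak_derivative_linear].
Qed.

Lemma has_weak_derivatives_sub m U V v : open V -> V `<=` U ->
  has_weak_derivatives m U v -> has_weak_derivatives m V v.
Proof.
move=> oV VU [Lv Hv]; split; first exact: (L2_sub oV VU Lv).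
move=> s; have [g Lg wg] := Hv s.
by exists g; [exact: (L2_sub oV VU Lg)|exact: (weak_derivative_sub VU wg)].
Qed.

Lemma has_weak_derivatives_smooth m U f v : open U -> bounded_set U ->
  (forall n, Ck n f) -> L2 U v -> eqL2 U v f -> has_weak_derivatives m U v.
Proof.
move=> oU bU Cf Lv vf; split => // s.
have Lf : L2 U f by apply: L2_continuous => //; exact: (Ck_continuous (Cf 0%N)).
have [g Cg wg] := smooth_weak_derivative s bU Cf.
exists g; first by apply: L2_continuous => //; exact: (Ck_continuous (Cg 0%N)).
by apply: (weak_derivative_ae oU bU Lf Lv _ wg); exact: ae_eq_sym.
Qed.

(** The chosen weak derivative of a combination need not be the combination of the chosen ones,
    but [energy_formE] does not see the difference. *)
Lemma energy_form_linear m U (a : R) v w z : open U -> bounded_set U ->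
  has_weak_derivatives m U v -> has_weak_derivatives m U w -> has_weak_derivatives m U z ->
  energy_form m U (a *: v + w) z = a * energy_form m U v z + energy_form m U w z.
Proof.
move=> oU bU Xv Xw Xz; have mU := open_measurable_plane oU.
have [[[_ Hv] [_ Hw]] [_ Hz]] := (Xv, Xw, Xz).
have Dv s := wderP (Hv s); have Dw s := wderP (Hw s); have Dz s := wderP (Hz s).
rewrite (energy_form_wder oU bU Xv Xz) (energy_form_wder oU bU Xw Xz).
have LG s := L2_linear a (Dv s).1 (Dw s).1.
have wG s := weak_derivative_linear a oU bU Xv.1 Xw.1 (Dv s).1 (Dw s).1 (Dv s).2 (Dw s).2.
rewrite (energy_formE oU bU LG (fun s => (Dz s).1) wG (fun s => (Dz s).2)).
rewrite mulr_sumr -big_split/=; apply: eq_bigr => s _.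
have i1 := integrable_mulL2 oU (Dv s).1 (Dz s).1.
have i2 := integrable_mulL2 oU (Dw s).1 (Dz s).1.
rewrite -RintegralZl// -RintegralD//; last exact: (integrableZl mU a i1).
by apply: eq_Rintegral => x _; rewrite mulrDl -mulrA.
Qed.

Lemma energy_formC m U v w : energy_form m U v w = energy_form m U w v.
Proof.
by apply: eq_Rintegral => x _; apply: eq_bigr => s _; rewrite mulrC.
Qed.

Lemma energy_form_ge0 m U v : 0 <= energy_form m U v v.
Proof. by apply: Rintegral_ge0 => x _; apply: sumr_ge0 => s _; rewrite -expr2 sqr_ge0. Qed.

Lemma energy_form_ae m U v w z : open U -> bounded_set U -> L2 U v -> L2 U w -> eqL2 U v w ->
  energy_form m U v z = energy_form m U w z.
Proof.
move=> oU bU Lv Lw vw; apply: eq_Rintegral => x _; apply: eq_bigr => s _.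
by rewrite (wder_ae s oU bU Lv Lw vw).
Qed.

(** Polynomials are sums of products of the coordinate functions. *)
Lemma polynomial2_Ck k (p : R * R -> R) : polynomial2 k p -> forall n, Ck n p.
Proof.
move=> [c pE] n.
have Cc i : Ck n (coord i : R * R -> R).
  case: n => [|n]; split => //; try exact: continuous_coord.
  move=> j; have D (x : R * R) := @is_derive_coord_comp R id i 1 0 x (unit_vec j) 1 (is_derive_id _ _).
  have E : (fun y : R * R => id (1 * coord i y + 0)) = coord i.
    by apply/funext => y; rewrite mul1r addr0.
  rewrite E in D; split; first by move=> x; have [] := D x.
  rewrite (_ : (fun x => _) = cst (1 * coord i (unit_vec j) * 1)); first exact: Ck_cst.
  by apply/funext => x; have [_ ->] := D x.
have Cx i e : Ck n (fun x : R * R => coord i x ^+ e).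
  elim: e => [|e IH]; first exact: (Ck_cst n 1).
  rewrite (_ : (fun x => _) = coord i \* (fun x : R * R => coord i x ^+ e)); first exact: CkM.
  by apply/funext => x; rewrite exprS.
have Csum (I : Type) (r : seq I) (Q : pred I) (F : I -> R * R -> R) :
    (forall i, Ck n (F i)) -> Ck n (fun x => \sum_(i <- r | Q i) F i x).
  move=> CF; elim: r => [|i r IH].
    rewrite (_ : (fun x => _) = cst 0); first exact: Ck_cst.
    by apply/funext => x; rewrite big_nil.
  rewrite (_ : (fun x => _) = if Q i then F i \+ (fun x => \sum_(j <- r | Q j) F j x)
      else (fun x => \sum_(j <- r | Q j) F j x)); first by case: ifP => // _; exact: CkD.
  by apply/funext => x; rewrite big_cons; case: ifP.
rewrite (_ : p = fun x => \sum_(i < k.+1) \sum_(j < k.+1 | (i + j <= k)%N)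
    (cst (c i j) \* (fun x : R * R => coord 0 x ^+ i) \* (fun x : R * R => coord 1 x ^+ j)) x).
  apply: (Csum) => i; apply: (Csum) => j; apply: CkM => //; apply: CkM => //; exact: Ck_cst.
by apply/funext => x; rewrite pE; apply: eq_bigr => i _; apply: eq_bigr => j _.
Qed.
End weak_derivative.

Section piecewise.
Context {R : realType}.
Local Notation leb := (@lebesgue_measure R).
Local Notation leb2 := (leb \x leb)%E.
Variables (m : nat) (Omega : set (R * R)) (N : nat) (T : 'I_N -> 'I_3 -> R * R).
Hypothesis oO : open Omega.
Hypothesis bO : bounded_set Omega.
Hypothesis lipO : lipschitz_boundary Omega.
Hypothesis hT : triangulation Omega T.
Implicit Types (v w z : R * R -> R).

Let K j := (triangle (T j))°.
Let oK j : open (K j). Proof. exact: open_interior. Qed.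
Let KO j : K j `<=` Omega. Proof. exact: triangle_interior_sub. Qed.
Let bK j : bounded_set (K j).
Proof. by case: bO => B [Br HB]; exists B; split => // y By x /KO Ox; exact: HB. Qed.

Definition pw_Hm v : Prop := forall j, has_weak_derivatives m (K j) v.

Lemma pw_form_semi_inner_product : semi_inner_product pw_Hm (pw_form m T).
Proof.
split.
- split.
    move=> j; have C0 n : Ck n (cst 0 : R * R -> R) by exact: Ck_cst.
    apply: (has_weak_derivatives_smooth m (@oK j) (@bK j) C0); last exact: ae_eq_refl.
    by apply: (L2_continuous (@oK j) (@bK j)); exact: cst_continuous.
  by move=> c u v Xu Xv j; exact: (has_weak_derivatives_linear c (@oK j) (@bK j) (Xu j) (Xv j)).
- move=> w Xw c u v Xu Xv; rewrite /pw_form mulr_sumr -big_split/=; apply: eq_bigr => j _.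
  exact: (energy_form_linear c (@oK j) (@bK j) (Xu j) (Xv j) (Xw j)).
- by move=> u v; apply: eq_bigr => j _; exact: energy_formC.
- by move=> u; apply: sumr_ge0 => j _; exact: energy_form_ge0.
Qed.

Lemma pw_form_ae v w z : L2 Omega v -> L2 Omega w -> eqL2 Omega v w ->
  pw_form m T v z = pw_form m T w z.
Proof.
move=> Lv Lw vw; apply: eq_bigr => j _.
exact: (energy_form_ae m z (@oK j) (@bK j) (L2_sub (@oK j) (@KO j) Lv)
  (L2_sub (@oK j) (@KO j) Lw) (eqL2_sub (@KO j) vw)).
Qed.

Lemma pw_polynomial_pw_Hm v : pw_polynomial m Omega T v -> pw_Hm v.
Proof.
move=> [Lv Pv] j; have [p Pp vp] := Pv j.
exact: (has_weak_derivatives_smooth m (@oK j) (@bK j) (polynomial2_Ck Pp)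
  (L2_sub (@oK j) (@KO j) Lv) vp).
Qed.

Lemma Hm0_L2 v : Hm0 m Omega v -> L2 Omega v.
Proof. by move=> [[]]. Qed.

Lemma Hm0_has_weak_derivatives v : Hm0 m Omega v -> has_weak_derivatives m Omega v.
Proof. by move=> [[Lv Hv] _]; split => // s; apply: Hv; rewrite size_tuple. Qed.

Lemma Hm0_pw_Hm v : Hm0 m Omega v -> pw_Hm v.
Proof.
by move=> /Hm0_has_weak_derivatives Hv j; exact: (has_weak_derivatives_sub (@oK j) (@KO j) Hv).
Qed.

(** The restrictions of the weak derivatives on [Omega] are weak derivatives on the triangles, and
    the integrals over the triangles add up. *)
Lemma pw_form_Hm0 v w : Hm0 m Omega v -> Hm0 m Omega w ->
  pw_form m T v w = energy_form m Omega v w.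
Proof.
move=> /Hm0_has_weak_derivatives Xv /Hm0_has_weak_derivatives Xw; have [[_ Hv] [_ Hw]] := (Xv, Xw).
have Dv s := wderP (Hv s); have Dw s := wderP (Hw s).
have I (s : m.-tuple 'I_2) := integrable_mulL2 oO (Dv s).1 (Dw s).1.
rewrite (energy_form_wder oO bO Xv Xw) /pw_form.
rewrite [RHS](eq_bigr (fun s : m.-tuple 'I_2 =>
    \sum_j \int[leb2]_(x in K j) (wder Omega s v x * wder Omega s w x))); last first.
  by move=> s _; apply: (Rintegral_triangulation lipO hT oO); exact: I.
rewrite exchange_big/=; apply: eq_bigr => j _.
exact: (energy_formE (@oK j) (@bK j)
  (fun s => L2_sub (@oK j) (@KO j) (Dv s).1) (fun s => L2_sub (@oK j) (@KO j) (Dw s).1)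
  (fun s => weak_derivative_sub (@KO j) (Dv s).2) (fun s => weak_derivative_sub (@KO j) (Dw s).2)).
Qed.

Let Idx : finType := ('I_N * 'I_m.+1 * 'I_m.+1)%type.

(** A relation and not a function: the entries with [m < k + l] are free. *)
Definition pw_coefficients v (c : 'rV[R]_#|Idx|) : Prop :=
  L2 Omega v /\ forall j, eqL2 (K j) v (fun x => \sum_(k < m.+1) \sum_(l < m.+1 | (k + l <= m)%N)
    c 0 (enum_rank (j, k, l)) * x.1 ^+ k * x.2 ^+ l).

Lemma pw_coefficients0 : pw_coefficients 0 0.
Proof.
split; first by apply: L2_continuous => //; exact: cst_continuous.
move=> j; apply: aeW => x _; rewrite big1// => k _; rewrite big1// => l _.
by rewrite mxE !mul0r.
Qed.

Lemma pw_coefficients_linear (a : R) u v c d : pw_coefficients u c -> pw_coefficients v d ->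
  pw_coefficients (a *: u + v) (a *: c + d).
Proof.
move=> [Lu uc] [Lv vd]; split; first exact: L2_linear.
move=> j; apply: filterS2 (uc j) (vd j) => x h1 h2 Kx.
transitivity (a * u x + v x) => //; rewrite h1// h2//.
rewrite mulr_sumr -big_split; apply: eq_bigr => k _.
rewrite mulr_sumr -big_split; apply: eq_bigr => l _.
by rewrite !mxE /= !mulrDl !mulrA.
Qed.

Lemma pw_coefficients_null u : pw_coefficients u 0 -> pw_form m T u u = 0.
Proof.
move=> [Lu uc]; apply: big1 => j _.
have z0 : eqL2 (K j) u 0.
  apply: filterS (uc j) => x h Kx; rewrite h// big1// => k _; rewrite big1// => l _.
  by rewrite mxE !mul0r.
have L0 : L2 (K j) 0.
  by apply: (L2_continuous (@oK j) (@bK j)); exact: cst_continuous.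
have LK := L2_sub (@oK j) (@KO j) Lu.
have C0 n : Ck n (cst 0 : R * R -> R) by exact: Ck_cst.
have H0 := has_weak_derivatives_smooth m (@oK j) (@bK j) C0 L0 (ae_eq_refl _ _ _).
rewrite (energy_form_ae m u (@oK j) (@bK j) LK L0 z0).
have Hu := has_weak_derivatives_smooth m (@oK j) (@bK j) C0 LK z0.
have := energy_form_linear 1 (@oK j) (@bK j) H0 H0 Hu.
rewrite scaler0 addr0 mul1r => /eqP; rewrite -subr_eq subrr eq_sym => /eqP.
by [].
Qed.

Lemma pw_polynomial_coefficients w : pw_polynomial m Omega T w ->
  exists c, pw_coefficients w c.
Proof.
move=> [Lw Pw].
have /choice[c Hc] : forall j, exists c : nat -> nat -> R, eqL2 (K j) w
    (fun x => \sum_(k < m.+1) \sum_(l < m.+1 | (k + l <= m)%N) c k l * x.1 ^+ k * x.2 ^+ l).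
  move=> j; have [p [c pE] wp] := Pw j; exists c.
  by apply: filterS wp => x h Kx; rewrite h// pE.
pose coef (q : 'I_N * 'I_m.+1 * 'I_m.+1) := c q.1.1 q.1.2 q.2.
exists (\row_i coef (enum_val i)); split => // j.
apply: filterS (Hc j) => x h Kx; rewrite h//.
by apply: eq_bigr => k _; apply: eq_bigr => l _; rewrite mxE (enum_rankK (j, k, l)).
Qed.
End piecewise.

(** * Petrov--Galerkin quasi-optimality *)

Theorem theorem3p3 (R : realType) (m : nat) (Omega : set (R * R))
  (hOmega : polygonal_lipschitz_domain Omega)
  (N : nat) (T : 'I_N -> 'I_3 -> R * R) (sigma : R)
  (hT : triangulation Omega T) (hsigma : shape_regular sigma T)
  (Vnc : set (R * R -> R))
  (hVnc : L2_subspace Omega Vnc)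
  (hVncP : Vnc `<=` pw_polynomial m Omega T)
  (hVncnorm : norm_on Omega Vnc (pw_norm m T))
  (Inc : (R * R -> R) -> R * R -> R) (kappa : R)
  (hInc : operator Omega (Hm0 m Omega) Vnc Inc)
  (hkappa : 0 < kappa)
  (hIncorth : forall v w, Hm0 m Omega v -> pw_polynomial m Omega T w ->
     pw_form m T (v - Inc v) w = 0)
  (hIncapprox : forall v, Hm0 m Omega v ->
     (L2norm Omega (fun x => (mesh_size T x) ^- m * (v x - Inc v x))%R <=
      (kappa * pw_norm m T (v - Inc v))%:E)%E)
  (J : (R * R -> R) -> R * R -> R) (LambdaJ : R)
  (hJ : linear_operator Omega Vnc (Hm0 m Omega) J)
  (hJinv : forall w, Vnc w -> eqL2 Omega (Inc (J w)) w)
  (hJqo : forall w v, Vnc w -> Hm0 m Omega v ->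
     pw_norm m T (w - J w) <= LambdaJ * pw_norm m T (w - v))
  (hVdiff : Hm0 m Omega `\` Vnc !=set0)
  (hVnc0 : nonzero Omega Vnc !=set0) :
  [/\ forall v, Hm0 m Omega v ->
        exists2 p, petrov_galerkin m T Vnc J v p &
          forall q, petrov_galerkin m T Vnc J v q -> eqL2 Omega q p,
      forall v p, Hm0 m Omega v -> Vnc p ->
        (petrov_galerkin m T Vnc J v p <->
         forall w, Vnc w -> pw_form m T p w = energy_form m Omega v (J w)) &
      forall P : (R * R -> R) -> R * R -> R,
        (forall v, Hm0 m Omega v -> petrov_galerkin m T Vnc J v (P v)) ->
        Cqo m T (Hm0 m Omega) Vnc Inc P =
          sqrte (1 + Lambda0 m Omega T Vnc J ^+ 2)%E /\
        sqrte (1 + Lambda0 m Omega T Vnc J ^+ 2)%E =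
          opnorm m Omega T Vnc J].

Proof.
have [[oO _ _] [bO lipO _]] := hOmega.
have [VL2 V0 Vlin Vae] := hVnc; have [_ n_eq0 _ _] := hVncnorm.
have [[VJ Jae] Jlin] := hJ; have [VI Iae] := hInc.
pose V := Hm0 m Omega; pose a := pw_form m T; pose X := pw_Hm m T.
have ha : semi_inner_product X a := pw_form_semi_inner_product m bO lipO hT.
have VX v : V v -> X v by exact: Hm0_pw_Hm.
have WX w : Vnc w -> X w by move=> /hVncP; exact: (pw_polynomial_pw_Hm bO lipO hT).
have VL v : V v -> L2 Omega v by exact: Hm0_L2.
have sW : linear_subspace Vnc by split.
have sX : linear_subspace X by case: ha.
have pae u v z : L2 Omega u -> L2 Omega v -> eqL2 Omega u v -> a u z = a v z.
  exact: (pw_form_ae m bO lipO hT).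
have aC u v : a u v = a v u := formC ha u v.
have orthI v w : V v -> Vnc w -> a (v - Inc v) w = 0.
  by move=> Vv /hVncP Pw; exact: hIncorth.
have IJ w z : Vnc w -> X z -> a (Inc (J w) - w) z = 0.
  move=> Ww Xz; have WIJ := VI _ (VJ _ Ww).
  rewrite (formBl ha (WX _ WIJ) (WX _ Ww) Xz).
  by rewrite (pae _ _ z (VL2 _ WIJ) (VL2 _ Ww) (hJinv _ Ww)) subrr.
(* turns the Petrov--Galerkin equations into a Galerkin problem for [p] in [Vnc] *)
have aJ p w : Vnc p -> Vnc w -> a p (J w) = a p w.
  move=> Wp Ww; apply/eqP; rewrite -subr_eq0; apply/eqP.
  rewrite -(formBr ha (VX _ (VJ _ Ww)) (WX _ Ww) (WX _ Wp)) aC.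
  exact: (orthJ ha VX WX VI VJ orthI IJ).
have Jlin_form v : V v -> linear_on Vnc (fun w => a v (J w)).
  move=> Vv c w z Ww Wz.
  have Wcz : Vnc (c *: w + z) by exact: Vlin.
  have Xw := VX _ (VJ _ Ww); have Xz := VX _ (VJ _ Wz).
  rewrite aC (pae _ (c *: J w + J z) v (VL _ (VJ _ Wcz)) _ (Jlin c _ _ Ww Wz)); last first.
    by apply: L2_linear; apply: VL; exact: VJ.
  rewrite (formDl ha _ Xz (VX _ Vv)) ?(formZl ha _ Xw (VX _ Vv)) 1?aC 1?(aC (J z))//.
  exact: (subspaceZ sX).
have null0 w : Vnc w -> a w w = 0 -> eqL2 Omega w 0.
  by move=> Ww w0; apply/n_eq0 => //; rewrite /pw_norm -/(a w w) w0 sqrtr0.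
(* a null vector of [Vnc] represents zero, so that [J] sends it to a representative of [J 0] *)
have Jnull v w : V v -> Vnc w -> a w w = 0 -> a v (J w) = 0.
  move=> Vv Ww w0; rewrite aC (pae _ (J 0) v (VL _ (VJ _ Ww)) (VL _ (VJ _ V0)) (Jae _ _ Ww V0 (null0 _ Ww w0))).
  by rewrite aC; exact: (linear_on0 sW (Jlin_form _ Vv)).
have nullI v : V v -> seminorm a (v - Inc v) = 0 -> Vnc v.
  move=> Vv nv; have Lv := VL _ Vv; have WIv := VI _ Vv; have LI := VL2 _ WIv.
  have Ld : L2 Omega (v - Inc v) by rewrite addrC -scaleN1r; exact: L2_linear.
  have := hIncapprox _ Vv; rewrite -[pw_norm m T _]/(seminorm a _) nv mulr0 => H.
  have d0 := mesh_L2norm_eq0 hT oO Ld H.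
  apply: (Vae _ _ WIv Lv); apply: filterS d0 => x h Ox.
  by apply/esym/eqP; rewrite -subr_eq0; apply/eqP; exact: h.
have galE v p : V v -> Vnc p ->
    (petrov_galerkin m T Vnc J v p <-> forall w, Vnc w -> a p w = a v (J w)).
  move=> Vv Wp; have gal w : Vnc w -> a (v - p) (J w) = a v (J w) - a p w.
    move=> Ww; rewrite (formBl ha (VX _ Vv) (WX _ Wp) (VX _ (VJ _ Ww))).
    by rewrite (aJ _ _ Wp Ww).
  split=> [[_ H] w Ww|H].
    by have E : a (v - p) (J w) = 0 := H w Ww; move: E; rewrite (gal w Ww) => /subr0_eq ->.
  split=> [|w Ww]; first exact: Wp.
  by apply: etrans (gal w Ww) _; rewrite (H w Ww) subrr.
split.
- move=> v Vv.
  have [p Wp Hp] := riesz_representation ha sW WX (pw_coefficients0 m T oO bO)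
    (@pw_coefficients_linear R m Omega N T) (pw_coefficients_null bO lipO hT)
    (fun w Ww => pw_polynomial_coefficients (hVncP w Ww)) (Jlin_form v Vv) (Jnull v ^~ Vv).
  exists p; first exact/galE.
  move=> q Hq; have Wq := Hq.1; move/(galE _ _ Vv Wq) : Hq => Hq.
  have Wd : Vnc (q - p) by exact: (subspaceB sW).
  have d0 : a (q - p) (q - p) = 0.
    by rewrite (formBl ha (WX _ Wq) (WX _ Wp) (WX _ Wd)) Hq// Hp// subrr.
  apply: filterS (null0 _ Wd d0) => x h Ox.
  by apply/eqP; rewrite -subr_eq0; apply/eqP; exact: h.
- move=> v p Vv Wp; apply: (iff_trans (galE _ _ Vv Wp)).
  have E w (Ww : Vnc w) := pw_form_Hm0 oO bO lipO hT Vv (VJ _ Ww).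
  by split=> H w Ww; [exact: etrans (H w Ww) (E w Ww)|exact: etrans (H w Ww) (esym (E w Ww))].
- move=> P HP.
  have WP v : V v -> Vnc (P v) by move=> /HP[].
  have galP v w : V v -> Vnc w -> a (v - P v) (J w) = 0 by move=> /HP[_ H] /H.
  have SE w : nonzero Omega Vnc w <-> Vnc w /\ seminorm a w != 0.
    split=> [[Ww w0]|[Ww /eqP w0]]; split => //.
      by apply/eqP => H; apply: w0; apply/n_eq0.
    by move=> /(n_eq0 _ Ww).
  (* [J 0] is null, so that the quasi-optimality of [J] bounds it *)
  have hL w : Vnc w -> seminorm a (w - J w) <= LambdaJ * seminorm a w.
    move=> Ww; have J0n : a (J 0) (J 0) = 0 := linear_on0 sW (Jlin_form _ (VJ _ V0)).
    have XJ0 := VX _ (VJ _ V0); have Xw := WX _ Ww; have Xd := subspaceB sX Xw XJ0.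
    have z0 z : X z -> a z (J 0) = 0 by move=> Xz; rewrite aC; exact: (form_null ha XJ0 Xz J0n).
    have E : a (w - J 0) (w - J 0) = a w w.
      rewrite (formBr ha Xw XJ0 Xd) (z0 _ Xd) subr0 (formBl ha Xw XJ0 Xw) (aC (J 0)).
      by rewrite (z0 _ Xw) subr0.
    have := hJqo w (J 0) Ww (VJ _ V0).
    by have -> : pw_norm m T (w - J 0) = seminorm a w := congr1 (@Num.sqrt R) E.
  exact: (quasi_optimality_constants ha VX sW WX VI VJ WP orthI IJ galP nullI hVdiff hVnc0 SE hL).
Qed.
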